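(* Let $(X,\mu,S,T)$ be an ergodic measure preserving system with commuting invertible measure preserving transformations $S$ and $T$. Then for any $f_1,f_2,f_3\in L^{\infty}(\mu)$ the averages \[\frac{1}{N^2}\sum_{i,j=0}^{N-1} f_1(S^i x)\,f_2(T^j x)\,f_3(S^iT^j x)\] converge for $\mu$-almost every $x\in X$ as $N\to\infty$.
   Context: A system $(X,\mu,S,T)$ is a standard probability space $(X,\mu)$ with two commuting invertible measure preserving transformations $S,T$; it is ergodic if every set invariant under both $S$ and $T$ has measure $0$ or $1$. Functions are real valued. *)

(* Defs.v *)
From mathcomp Require Import all_boot all_order all_algebra.
From mathcomp Require Import all_classical all_reals all_analysis.
Set Implicit Arguments. Unset Strict Implicit. Unset Printing Implicit Defensive.
Import Order.TTheory GRing.Theory Num.Theory.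
Local Open Scope classical_set_scope.
Local Open Scope ring_scope.

(* A standard Borel space: measurably isomorphic to a Borel subset of R
   (equivalently, by Kuratowski's theorem, of any Polish space). *)
Definition standard_borel {d : measure_display} (X : measurableType d)
  (R : realType) : Prop :=
  exists f : X -> R, injective f /\ measurable_fun setT f /\
    (forall A : set X, measurable A -> measurable (f @` A)).

Definition inv_mpt {d : measure_display} (X : measurableType d) (R : realType)
  (mu : {measure set X -> \bar R}) (S : X -> X) : Prop :=
  measurable_fun setT S /\
  (exists Sinv : X -> X, cancel S Sinv /\ cancel Sinv S /\
                         measurable_fun setT Sinv) /\
  (forall A : set X, measurable A -> mu (S @^-1` A) = mu A).

Definition ergodic2 {d : measure_display} (X : measurableType d) (R : realType)
  (mu : {measure set X -> \bar R}) (S T : X -> X) : Prop :=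
  forall A : set X, measurable A -> S @^-1` A = A -> T @^-1` A = A ->
    mu A = 0%E \/ mu A = 1%E.

Definition Linfty {d : measure_display} (X : measurableType d) (R : realType)
  (mu : {measure set X -> \bar R}) (f : X -> R) : Prop :=
  measurable_fun setT f /\ exists M : R, {ae mu, forall x, `|f x| <= M}.

Definition avg2 {X : Type} {R : realType} (S T : X -> X) (f1 f2 f3 : X -> R)
  (N : nat) (x : X) : R :=
  (N%:R ^+ 2)^-1 * \sum_(i < N) \sum_(j < N)
     f1 (iter i S x) * f2 (iter j T x) * f3 (iter i S (iter j T x)).

(* Main.v *)
(** Idea.  Write [A_N h] for the averages of [f1 (S^i x) f2 (T^j x) h (S^i T^j x)].

    (1) Replacing the numbers [f1 (S^i x)], [f2 (T^j x)] on each translate of a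
    small box by the worst bounded vectors shows that, for every [H],
    [limsup |A_N g|] is at most the limit of the ergodic averages of [k_H], where
    [k_H y] is the cut norm of the [H] x [H] array [g (S^a T^b y)].  The mean of
    [k_H] equals the correlation of [g] with a dual function
    [D_H x = mean_(a, b < H) u_a (S^-a T^-b x) v_b (S^-a T^-b x)], [|D_H| <= 1].

    (2) On the space of triples [(y, a, b)] with [a, b < H], [A_N D_H] splits, up to
    [O (N / H)], as a mean of products of two one-parameter ergodic averages, under the
    shifts of [a] and of [b].  An ultralimit in [H] is a finitely additive measure
    preserved by both shifts, and the pointwise ergodic theorem, in a
    quantitative form valid for finitely additive means, makes the oscillation of
    [A_N D_H] small uniformly in [H].  Near-minimizers of the L2 norm in
    the convex hulls of the [D_H] turn this into one function [h] with
    [A_N h] almost convergent and [E (g h)] close to the mean of [k_H].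

    (3) Choose [h0] with [A_N h0] almost convergent and [E (f3 - h0)^2] almost minimal.
    Then [g = f3 - h0] is almost uncorrelated with the [h] of (2), so [k_H] has
    small mean for some [H], and by (1) [A_N g] is almost always small. *)
Require Import Defs.
From mathcomp Require Import all_boot all_order all_algebra.
From mathcomp Require Import all_classical all_reals all_analysis.
From mathcomp Require Import measurable_realfun.
From mathcomp Require Import ring lra zify.
Set Implicit Arguments. Unset Strict Implicit. Unset Printing Implicit Defensive.
Import Order.TTheory GRing.Theory Num.Theory numFieldNormedType.Exports.
Local Open Scope classical_set_scope.
Local Open Scope ring_scope.

(** * Cesaro means in one and two parameters *)

Section CesaroMeans.
Variable R : realType.
Implicit Types (p q : nat -> R) (N M : nat) (C : R).

Definition cmean N p : R := N%:R^-1 * \sum_(i < N) p i.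

Lemma eq_cmean N p q : (forall i, (i < N)%N -> p i = q i) -> cmean N p = cmean N q.
Proof. by move=> pq; congr (_ * _); apply: eq_bigr => i _; exact: pq. Qed.

Lemma cmeanD N p q : cmean N (fun i => p i + q i) = cmean N p + cmean N q.
Proof. by rewrite /cmean big_split mulrDr. Qed.

Lemma cmeanZl N a p : cmean N (fun i => a * p i) = a * cmean N p.
Proof. by rewrite /cmean -mulr_sumr mulrCA. Qed.

Lemma cmeanZr N a p : cmean N (fun i => p i * a) = cmean N p * a.
Proof. by rewrite /cmean -mulr_suml mulrA. Qed.

Lemma cmeanB N p q : cmean N (fun i => p i - q i) = cmean N p - cmean N q.
Proof.
rewrite -[in RHS]mulN1r -cmeanZl -cmeanD.
by apply: eq_cmean => i _; rewrite mulN1r.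
Qed.

Lemma cmean_cst N a : (0 < N)%N -> cmean N (fun=> a) = a.
Proof.
by move=> N0; rewrite /cmean sumr_const card_ord -[a *+ N]mulr_natl mulKf// pnatr_eq0 -lt0n.
Qed.

Lemma cmean0 p : cmean 0 p = 0.
Proof. by rewrite /cmean big_ord0 mulr0. Qed.

Lemma ler_cmean N p q : (forall i, (i < N)%N -> p i <= q i) -> cmean N p <= cmean N q.
Proof.
by move=> pq; rewrite ler_wpM2l ?invr_ge0//; apply: ler_sum => i _; exact: pq.
Qed.

Lemma ler_norm_cmean N p : `|cmean N p| <= cmean N (fun i => `|p i|).
Proof.
rewrite /cmean normrM ger0_norm ?invr_ge0//.
by rewrite ler_wpM2l ?invr_ge0// ler_norm_sum.
Qed.

Lemma cmean_le_cst N p C : 0 <= C -> (forall i, (i < N)%N -> p i <= C) -> cmean N p <= C.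
Proof.
move=> C0 pC; case: (posnP N) => [->|N0]; first by rewrite cmean0.
by rewrite -(cmean_cst C N0); exact: ler_cmean.
Qed.

Lemma cmean_bound N p C : 0 <= C -> (forall i, (i < N)%N -> `|p i| <= C) ->
  `|cmean N p| <= C.
Proof. by move=> C0 pC; apply: le_trans (ler_norm_cmean _ _) _; exact: cmean_le_cst. Qed.

Lemma cmean_exchange N M (c : nat -> nat -> R) :
  cmean N (fun i => cmean M (c i)) = cmean M (fun j => cmean N (c^~ j)).
Proof.
rewrite /cmean -!mulr_sumr exchange_big /= mulrCA.
by congr (_ * _); rewrite -mulr_sumr; congr (_ * _).
Qed.

(** Moving the window by one drops one term and gains another, which costs at most [2 * C / N]; then
    induct on [a]. *)
Lemma cmean_shift N p C a : (forall i, `|p i| <= C) ->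
  `|cmean N (fun i => p (a + i)%N) - cmean N p| <= 2 * C * a%:R / N%:R.
Proof.
move=> pC; have C0 : 0 <= C by apply: le_trans (pC 0%N).
elim: a => [|a IH].
  under eq_cmean do rewrite add0n.
  by rewrite subrr normr0 mulr0 mul0r.
have -> : cmean N (fun i => p (a.+1 + i)%N) =
    cmean N (fun i => p (a + i)%N) + (p (a + N)%N - p a) / N%:R.
  rewrite /cmean [X in _ = _ + X]mulrC -mulrDr; congr (_ * _).
  have := big_ord_recl N (fun i => p (a + i)%N) (idx := 0) (op := +%R).
  rewrite /= big_ord_recr /= addn0 => e.
  under eq_bigr do rewrite addSnnS.
  by apply: (addrI (p a)); rewrite -e; ring.
have -> : 2 * C * a.+1%:R / N%:R = 2 * C * a%:R / N%:R + 2 * C / N%:R.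
  by rewrite -[a.+1%:R]natr1 mulrDr mulr1 mulrDl.
rewrite addrAC; apply: le_trans (ler_normD _ _) _; apply: lerD IH _.
rewrite normrM normfV normr_nat ler_wpM2r ?invr_ge0//.
by apply: le_trans (ler_normB _ _) _; have := pC (a + N)%N; have := pC a; lra.
Qed.

Definition bmean N (c : nat -> nat -> R) : R := cmean N (fun i => cmean N (c i)).

Lemma eq_bmean N c d : (forall i j, (i < N)%N -> (j < N)%N -> c i j = d i j) ->
  bmean N c = bmean N d.
Proof. by move=> cd; apply: eq_cmean => i iN; apply: eq_cmean => j jN; exact: cd. Qed.

Lemma bmeanD N c d : bmean N (fun i j => c i j + d i j) = bmean N c + bmean N d.
Proof. by rewrite /bmean -cmeanD; apply: eq_cmean => i _; rewrite cmeanD. Qed.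

Lemma bmeanB N c d : bmean N (fun i j => c i j - d i j) = bmean N c - bmean N d.
Proof. by rewrite /bmean -cmeanB; apply: eq_cmean => i _; rewrite cmeanB. Qed.

Lemma bmeanZl N a c : bmean N (fun i j => a * c i j) = a * bmean N c.
Proof. by rewrite /bmean -cmeanZl; apply: eq_cmean => i _; rewrite cmeanZl. Qed.

Lemma bmean_cst N a : (0 < N)%N -> bmean N (fun _ _ => a) = a.
Proof.
by move=> N0; rewrite /bmean -[RHS](cmean_cst a N0); apply: eq_cmean => i _; rewrite cmean_cst.
Qed.

Lemma ler_bmean N c d : (forall i j, (i < N)%N -> (j < N)%N -> c i j <= d i j) ->
  bmean N c <= bmean N d.
Proof. by move=> cd; apply: ler_cmean => i iN; apply: ler_cmean => j jN; exact: cd. Qed.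

Lemma ler_norm_bmean N c : `|bmean N c| <= bmean N (fun i j => `|c i j|).
Proof.
by apply: le_trans (ler_norm_cmean _ _) _; apply: ler_cmean => i _; exact: ler_norm_cmean.
Qed.

Lemma bmean_bound N c C : 0 <= C ->
  (forall i j, (i < N)%N -> (j < N)%N -> `|c i j| <= C) -> `|bmean N c| <= C.
Proof.
by move=> C0 cC; apply: cmean_bound => // i iN; apply: cmean_bound => // j jN; exact: cC.
Qed.

Lemma bmean_exchange N M (c : nat -> nat -> nat -> nat -> R) :
  bmean N (fun i j => bmean M (c i j)) = bmean M (fun a b => bmean N (fun i j => c i j a b)).
Proof.
rewrite /bmean.
transitivity (cmean N (fun i => cmean M (fun a => cmean N (fun j => cmean M (c i j a))))).
  by apply: eq_cmean => i _; exact: cmean_exchange.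
rewrite cmean_exchange; apply: eq_cmean => a _.
rewrite [RHS]cmean_exchange; apply: eq_cmean => i _.
by rewrite cmean_exchange.
Qed.

Lemma bmeanM N p q : bmean N (fun i j => p i * q j) =
  bmean N (fun i _ => p i) * bmean N (fun _ j => q j).
Proof.
case: (posnP N) => [->|N0]; first by rewrite /bmean !cmean0 mul0r.
rewrite /bmean cmean_cst// -cmeanZr; apply: eq_cmean => i _.
by rewrite cmeanZl cmean_cst.
Qed.

Lemma bmean_shift N c C a b : (forall i j, `|c i j| <= C) ->
  `|bmean N (fun i j => c (a + i)%N (b + j)%N) - bmean N c|
     <= 2 * C * (a + b)%:R / N%:R.
Proof.
move=> cC; have C0 : 0 <= C by apply: le_trans (cC 0%N 0%N).
have -> : 2 * C * (a + b)%:R / N%:R = 2 * C * b%:R / N%:R + 2 * C * a%:R / N%:R.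
  by rewrite natrD; ring.
rewrite -[X in `|X|](subrKA (bmean N (fun i j => c (a + i)%N j))).
apply: le_trans (ler_normD _ _) _; apply: lerD.
- rewrite /bmean -cmeanB; apply: cmean_bound => [|i _].
    by rewrite divr_ge0// !mulr_ge0.
  exact: (@cmean_shift N (c (a + i)%N)).
- apply: (@cmean_shift N (fun i => cmean N (c i))) => i.
  exact: cmean_bound.
Qed.

(** The offsets satisfy [i + j < 2 * N], so each shifted mean of side [M] changes by at most
    [2 * C * (2 * N) / M]: averaging over short translates is harmless inside a long average. *)
Lemma bmean_bmean N M c C : (0 < N)%N -> (forall i j, `|c i j| <= C) ->
  `|bmean N (fun i j => bmean M (fun a b => c (i + a)%N (j + b)%N)) - bmean M c|
     <= 4 * C * N%:R / M%:R.
Proof.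
move=> N0 cC; have C0 : 0 <= C by apply: le_trans (cC 0%N 0%N).
rewrite -[X in _ - X](bmean_cst _ N0) -bmeanB; apply: bmean_bound => [|i j iN jN].
  by rewrite divr_ge0// !mulr_ge0.
apply: le_trans (bmean_shift M i j cC) _; rewrite ler_wpM2r ?invr_ge0//.
have : (i + j)%:R <= 2 * N%:R :> R by rewrite -natrM ler_nat; lia.
nra.
Qed.

Lemma div_small (x e : R) : 0 < e -> exists2 K, (0 < K)%N &
  forall N, (K <= N)%N -> x / N%:R <= e.
Proof.
move=> e0; exists (Num.truncn (x / e)).+1 => // N KN.
rewrite ler_pdivrMr ?ltr0n; last exact: leq_trans KN.
rewrite mulrC -ler_pdivrMr//; apply: ltW; apply: lt_le_trans (truncnS_gt _) _.
by rewrite ler_nat.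
Qed.

End CesaroMeans.

(** * Near-minimizers across a sequence of sets *)

Section NearMinimizers.
Variables (R : realType) (T : Type).

(** If every [s >= s0] failed, passing to later sets would raise the lower bound of [q] by [e] again
    and again, past the uniform bound [b]. *)
Lemma near_min (C : nat -> T -> Prop) (q : T -> R) (b : R) :
  (forall s, exists2 h, C s h & q h <= b) -> (forall s h, C s h -> 0 <= q h) ->
  forall (e : R) s0, 0 < e -> exists2 s, (s0 <= s)%N &
    forall s', (s <= s')%N -> exists2 h, C s' h & forall k, C s k -> q h <= q k + e.
Proof.
move=> Cne q0 e s0 e0; apply: contrapT => /forall2NP nmin.
have lb n : exists2 t, (s0 <= t)%N & forall h, C t h -> n%:R * e <= q h.
  elim: n => [|n [t s0t lbt]]; first by exists s0 => // h; rewrite mul0r; exact: q0.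
  have [//|/existsNP[t' /not_implyP[tt' /forall2NP nC]]] := nmin t.
  exists t'; first exact: leq_trans tt'.
  move=> h Ch; have [//|/existsNP[k /not_implyP[Ck /negP]]] := nC h.
  by rewrite -ltNge => kh; have := lbt _ Ck; rewrite -natr1; lra.
have [t _ lbt] := lb (Num.truncn (b / e)).+1.
have [h Ch hb] := Cne t.
have : b / e < (Num.truncn (b / e)).+1%:R by exact: truncnS_gt.
by rewrite ltr_pdivrMr//; have := lbt _ Ch; lra.
Qed.

End NearMinimizers.

(* A finitely additive integral on an algebra [B] of bounded functions; both
   the integral of a probability measure and its ultralimits are instances. *)
Record is_mean (R : realType) (W : Type) (B : (W -> R) -> Prop)
    (E : (W -> R) -> R) : Prop := IsMean {
  B_cst : forall c, B (fun=> c) ;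
  B_add : forall f g, B f -> B g -> B (fun w => f w + g w) ;
  B_mul : forall f g, B f -> B g -> B (fun w => f w * g w) ;
  B_pos : forall f, B f -> B (fun w => (0 < f w)%R%:R) ;
  B_bnd : forall f, B f -> exists C, forall w, `|f w| <= C ;
  E_cst : forall c, E (fun=> c) = c ;
  E_add : forall f g, B f -> B g -> E (fun w => f w + g w) = E f + E g ;
  E_scale : forall c f, B f -> E (fun w => c * f w) = c * E f ;
  E_le : forall f g, B f -> B g -> (forall w, f w <= g w) -> E f <= E g }.

Arguments B_add {R W B E} _ {f g}.
Arguments B_mul {R W B E} _ {f g}.
Arguments B_pos {R W B E} _ {f}.
Arguments B_bnd {R W B E} _ {f}.
Arguments E_add {R W B E} _ {f g}.
Arguments E_scale {R W B E} _ c {f}.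
Arguments E_le {R W B E} _ {f g}.

Definition preserves (R : realType) (W : Type) (B : (W -> R) -> Prop)
    (E : (W -> R) -> R) (S : W -> W) : Prop :=
  forall f, B f -> B (fun w => f (S w)) /\ E (fun w => f (S w)) = E f.

(* Finitary form of [E (limsup |G N - G N'|) <= e], meaningful for a finitely
   additive [E]: [K] does not depend on [n]. *)
Definition osc_le (R : realType) (W : Type) (B : (W -> R) -> Prop)
    (E : (W -> R) -> R) (e : R) (G : nat -> W -> R) : Prop :=
  exists K, forall n, exists Q, [/\ B Q, E Q <= e &
    forall N N' w, (K <= N <= n)%N -> (K <= N' <= n)%N -> `|G N w - G N' w| <= Q w].

(** * Calculus of finitely additive means *)

Section Mean.
Variables (R : realType) (W : Type) (B : (W -> R) -> Prop) (E : (W -> R) -> R).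
Hypothesis mE : is_mean B E.
Implicit Types (f g h F : W -> R) (S T : W -> W) (c C e l : R).

Lemma B_scale c f : B f -> B (fun w => c * f w).
Proof. by move=> Bf; apply: (B_mul mE (B_cst mE c) Bf). Qed.

Lemma B_opp f : B f -> B (fun w => - f w).
Proof. by move=> /(B_scale (-1)); congr B; apply/funext => w; rewrite mulN1r. Qed.

Lemma B_sub f g : B f -> B g -> B (fun w => f w - g w).
Proof. by move=> Bf /B_opp; exact: (B_add mE). Qed.

Lemma B_max0 f : B f -> B (fun w => Num.max 0 (f w)).
Proof.
move=> Bf; have := (B_mul mE) Bf ((B_pos mE) Bf); congr B; apply/funext => w.
by case: ltP; rewrite ?mulr1 ?mulr0.
Qed.

Lemma B_norm f : B f -> B (fun w => `|f w|).
Proof.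
move=> Bf; have := (B_add mE) (B_max0 Bf) (B_max0 (B_opp Bf)); congr B; apply/funext => w.
have [f0|f0] := leP 0 (f w).
  by rewrite max_l ?oppr_le0// ger0_norm ?addr0.
by rewrite max_r ?oppr_ge0 ?ltW// ltr0_norm ?add0r.
Qed.

Lemma B_sum n (F : nat -> W -> R) : (forall i, B (F i)) -> B (fun w => \sum_(i < n) F i w).
Proof.
move=> BF; elim: n => [|n IH].
  by have := (B_cst mE) 0; congr B; apply/funext => w; rewrite big_ord0.
by have := (B_add mE) IH (BF n); congr B; apply/funext => w; rewrite big_ord_recr.
Qed.

Lemma B_cmean n (F : nat -> W -> R) : (forall i, B (F i)) -> B (fun w => cmean n (F^~ w)).
Proof. by move=> BF; apply: B_scale; exact: B_sum. Qed.

Lemma B_bmean n (F : nat -> nat -> W -> R) : (forall i j, B (F i j)) ->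
  B (fun w => bmean n (fun i j => F i j w)).
Proof.
move=> BF; apply: (B_cmean n (F := fun i w => cmean n (fun j => F i j w))) => i.
exact: B_cmean.
Qed.

Lemma E_opp f : B f -> E (fun w => - f w) = - E f.
Proof.
by move=> Bf; rewrite -mulN1r -(E_scale mE)//; congr E; apply/funext => w; rewrite mulN1r.
Qed.

Lemma E_sub f g : B f -> B g -> E (fun w => f w - g w) = E f - E g.
Proof. by move=> Bf Bg; rewrite (E_add mE) ?E_opp//; exact: B_opp. Qed.

Lemma E_ge0 f : B f -> (forall w, 0 <= f w) -> 0 <= E f.
Proof. by move=> Bf f0; rewrite -((E_cst mE) 0); apply: (E_le mE) => //; exact: (B_cst mE). Qed.

Lemma E_le_cst f c : B f -> (forall w, f w <= c) -> E f <= c.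
Proof. by move=> Bf f0; rewrite -((E_cst mE) c); apply: (E_le mE) => //; exact: (B_cst mE). Qed.

Lemma E_norm_le f c : B f -> (forall w, `|f w| <= c) -> `|E f| <= c.
Proof.
move=> Bf fc; rewrite ler_norml; apply/andP; split.
  rewrite -((E_cst mE) (- c)); apply: (E_le mE) => //; first exact: (B_cst mE).
  by move=> w; have := fc w; rewrite ler_norml => /andP[].
by apply: E_le_cst => // w; have := fc w; rewrite ler_norml => /andP[].
Qed.

Lemma E_sum n (F : nat -> W -> R) : (forall i, B (F i)) ->
  E (fun w => \sum_(i < n) F i w) = \sum_(i < n) E (F i).
Proof.
move=> BF; elim: n => [|n IH].
  by rewrite big_ord0 -[RHS](E_cst mE); congr E; apply/funext => w; rewrite big_ord0.
rewrite big_ord_recr -IH /= -(E_add mE)//; last exact: B_sum.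
by congr E; apply/funext => w; rewrite big_ord_recr.
Qed.

Lemma E_cmean n (F : nat -> W -> R) : (forall i, B (F i)) ->
  E (fun w => cmean n (F^~ w)) = cmean n (fun i => E (F i)).
Proof. by move=> BF; rewrite (E_scale mE) ?E_sum//; exact: B_sum. Qed.

Lemma E_bmean n (F : nat -> nat -> W -> R) : (forall i j, B (F i j)) ->
  E (fun w => bmean n (fun i j => F i j w)) = bmean n (fun i j => E (F i j)).
Proof.
move=> BF; rewrite (E_cmean n (F := fun i w => cmean n (fun j => F i j w))) => [|i].
  by apply: eq_cmean => i _; exact: E_cmean.
exact: B_cmean.
Qed.

(** The inequality [2 * e * |f| <= f ^ 2 + e ^ 2] takes the place of Cauchy-Schwarz. *)
Lemma E_norm_sqr f e : 0 < e -> B f -> E (fun w => f w ^+ 2) <= e ^+ 2 ->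
  E (fun w => `|f w|) <= e.
Proof.
move=> e0 Bf Ef; have Bf2 : B (fun w => f w ^+ 2) by exact: (B_mul mE).
suff : E (fun w => (2 * e) * `|f w|) <= e ^+ 2 + e ^+ 2.
  by rewrite (E_scale mE); [nra|exact: B_norm].
apply: (@le_trans _ _ (E (fun w => f w ^+ 2 + e ^+ 2))).
  apply: (E_le mE); [exact/B_scale/B_norm|exact/(B_add mE)/(B_cst mE)|move=> w].
  by rewrite -[f w ^+ 2]real_normK ?num_real//; have := sqr_ge0 (`|f w| - e); nra.
by rewrite (E_add mE) ?(E_cst mE) ?lerD2r//; exact: (B_cst mE).
Qed.

(** Parallelogram law: two near-minimizers of the L2 norm whose midpoint competes with them are
    close. [B] need not be complete, so no limit is taken; instead one [h] is fixed and every scale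
    [s'] has its own [h'] near it. *)
Lemma conv_cauchy (C : nat -> (W -> R) -> Prop) (b : R) :
  (forall s, exists2 h, C s h & E (fun w => h w ^+ 2) <= b) ->
  (forall s s' h, (s <= s')%N -> C s' h -> C s h) ->
  (forall s h, C s h -> B h) ->
  (forall s h h', C s h -> C s h' -> C s (fun w => 2^-1 * (h w + h' w))) ->
  forall e s0, 0 < e -> exists s, (s0 <= s)%N /\ exists2 h, C s h &
    forall s', exists2 h', C s' h' & E (fun w => (h w - h' w) ^+ 2) <= e.
Proof.
move=> Cne Cdec CB Cmid e s0 e0.
have B2 h : B h -> B (fun w => h w ^+ 2) by move=> Bh; exact: (B_mul mE).
pose q h := E (fun w => h w ^+ 2).
have q0 s h : C s h -> 0 <= q h.
  by move=> /CB/B2 Bh2; apply: E_ge0 => // w; exact: sqr_ge0.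
have e40 : 0 < e / 4 by lra.
have [s s0s near] := near_min Cne q0 s0 e40.
exists s; split => //; have [h Ch minh] := near _ (leqnn s); exists h => // s'.
have [h' Ch' minh'] := near _ (leq_maxl s s').
exists h'; first exact: Cdec (leq_maxr s s') Ch'.
have Csh' := Cdec _ _ _ (leq_maxl s s') Ch'.
have Bh := CB _ _ Ch; have Bh' := CB _ _ Ch'.
have Ck := Cmid _ _ _ Ch Csh'; have Bk := CB _ _ Ck.
have := minh _ Ck; have := minh' _ Ck; rewrite /q.
have -> : E (fun w => (h w - h' w) ^+ 2) = 2 * E (fun w => h w ^+ 2) +
   2 * E (fun w => h' w ^+ 2) - 4 * E (fun w => (2^-1 * (h w + h' w)) ^+ 2).
  rewrite -!(E_scale mE); [|exact: B2..].
  rewrite -(E_add mE); [|exact/B_scale/B2..].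
  rewrite -E_sub; [|by apply: (B_add mE) => //; exact/B_scale/B2|exact/B_scale/B2].
  by congr E; apply/funext => w; field.
lra.
Qed.

(** * The maximal inequality for one map *)

Section Iterates.
Variable S : W -> W.
Hypothesis pS : preserves B E S.

Lemma B_iter n f : B f -> B (fun w => f (iter n S w)).
Proof. by elim: n f => // n IH f Bf; apply: (IH (fun w => f (S w))); exact: (pS Bf).1. Qed.

Lemma E_iter n f : B f -> E (fun w => f (iter n S w)) = E f.
Proof.
elim: n f => // n IH f Bf; rewrite -[RHS](pS Bf).2.
by apply: (IH (fun w => f (S w))); exact: (pS Bf).1.
Qed.

(** This is the maximum over [N <= n] of the sums of [f (S^i w) - l], [i < N]; the recursion makes
    membership in [B] an easy induction. *)
Fixpoint run_max (l : R) f n w : R :=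
  if n is n'.+1 then Num.max 0 (f w - l + run_max l f n' (S w)) else 0.

Lemma run_max_ge0 l f n w : 0 <= run_max l f n w.
Proof. by case: n => //= n; rewrite le_max lexx. Qed.

Lemma run_maxS l f n w : run_max l f n w <= run_max l f n.+1 w.
Proof.
elim: n w => [|n IH] w; first exact: run_max_ge0.
by rewrite /= ge_max le_max lexx /= le_max lerD2l IH orbT.
Qed.

Lemma sum_le_run_max l f n N w : (N <= n)%N ->
  \sum_(i < N) (f (iter i S w) - l) <= run_max l f n w.
Proof.
elim: N n w => [|N IH] [|n] w //; rewrite ?big_ord0 ?run_max_ge0// ltnS => Nn.
rewrite big_ord_recl /= le_max; apply/orP; right; rewrite lerD2l.
apply: le_trans (IH _ (S w) Nn); apply: ler_sum => i _.
by rewrite -iterS iterSr.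
Qed.

Lemma B_run_max l f n : B f -> B (run_max l f n).
Proof.
move=> Bf; elim: n => [|n IH]; first exact: (B_cst mE).
apply: (B_max0 (f := fun w => f w - l + run_max l f n (S w))).
by apply: (B_add mE _ (pS IH).1); apply: B_sub => //; exact: (B_cst mE).
Qed.

(* Garsia's argument: [(f - l) 1_{run_max > 0}] dominates the coboundary
   [run_max - run_max o S], whose mean vanishes. *)
Lemma maximal_ineq f C l n : B f -> 0 < l -> 0 <= C -> (forall w, 0 <= f w <= C) ->
  exists Q, [/\ B Q, (forall w, 0 <= Q w <= l + C), E Q <= l + C / l * E f &
    forall N w, (N <= n)%N -> cmean N (fun i => f (iter i S w)) <= Q w].
Proof.
move=> Bf l0 C0 fC; set H := run_max l f n.+1.
have BH : B H by exact: B_run_max.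
have BP := (B_pos mE) BH; set P := fun w => (0 < H w)%R%:R in BP *.
have P01 w : 0 <= P w <= 1 by rewrite /P; case: ltP => _; rewrite lexx ler01.
(* Where [H] vanishes, all means of length at most [n] are at most [l]; elsewhere the trivial bound
   [C] is used. *)
exists (fun w => l + C * P w); split.
- by apply: (B_add mE (B_cst mE _)); exact: B_scale.
- move=> w; have /andP[P0 P1] := P01 w; rewrite addr_ge0 ?mulr_ge0 ?(ltW l0)//=.
  by rewrite lerD2l ler_piMr.
- rewrite (E_add mE) ?(E_scale mE) ?(E_cst mE)//; [|exact: (B_cst mE)|exact: B_scale].
  rewrite lerD2l -mulrA ler_wpM2l// [leRHS]mulrC ler_pdivlMr//.
  have : 0 <= E (fun w => f w * P w - l * P w).
    have <- : E (fun w => H w - H (S w)) = 0.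
      by rewrite E_sub ?(pS BH).2 ?subrr//; exact: (pS BH).1.
    apply: (E_le mE).
    - by apply: B_sub => //; exact: (pS BH).1.
    - by apply: B_sub; [exact: (B_mul mE)|exact: B_scale].
    move=> w; have := run_maxS l f n (S w); rewrite -/H => HS.
    rewrite /P; case: ltP => [H0|Hle]; rewrite ?mulr1 ?mulr0.
      have : H w = f w - l + run_max l f n (S w).
        by move: H0; rewrite /H /= lt_max ltxx /= => H0; rewrite max_r// ltW.
      by lra.
    by have := run_max_ge0 l f n.+1 (S w); rewrite -/H; lra.
  rewrite E_sub ?(E_scale mE)//; [|exact: (B_mul mE)|exact: B_scale].
  have : E (fun w => f w * P w) <= E f.
    apply: (E_le mE) => //; [exact: (B_mul mE)|move=> w].
    by have /andP[_ P1] := P01 w; have /andP[f0 _] := fC w; rewrite ler_piMr.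
  by lra.
- move=> N w Nn; rewrite /P; case: ltP => [_|H0].
    rewrite mulr1; apply: (@le_trans _ _ C); last by lra.
    by apply: cmean_le_cst => // i _; case/andP: (fC (iter i S w)).
  rewrite mulr0 addr0; case: (posnP N) => [->|N0]; first by rewrite cmean0 ltW.
  rewrite -subr_le0 -[X in _ - X](cmean_cst l N0) -cmeanB.
  rewrite pmulr_rle0 ?invr_gt0 ?ltr0n//.
  by apply: le_trans H0; apply: sum_le_run_max; exact: leqW.
Qed.

(** The pointwise bound on [Q] is recorded so that [Q] can itself be fed into the maximal inequality
    for a second map. *)
Lemma maximal_small C e : 0 < C -> 0 < e -> exists2 dl : R, 0 < dl &
  forall f, B f -> (forall w, 0 <= f w <= C) -> E f <= dl -> forall n,
  exists Q, [/\ B Q, (forall w, 0 <= Q w <= e + C), E Q <= e &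
    forall N w, (N <= n)%N -> cmean N (fun i => f (iter i S w)) <= Q w].
Proof.
(* At level [l = e / 2], the bound [l + C / l * dl] equals [e] for this [dl]. *)
move=> C0 e0; exists (e ^+ 2 / (4 * C)); first by rewrite divr_gt0 ?exprn_gt0 ?mulr_gt0.
move=> f Bf fC Ef n.
have e20 : 0 < e / 2 by lra.
have [Q [BQ Q1 EQ maxQ]] := maximal_ineq n Bf e20 (ltW C0) fC.
exists Q; split=> //; first by move=> w; have /andP[] := Q1 w; lra.
apply: (le_trans EQ).
apply: (@le_trans _ _ (e / 2 + C / (e / 2) * (e ^+ 2 / (4 * C)))).
  by rewrite lerD2l ler_wpM2l// divr_ge0// ltW.
rewrite le_eqVlt; apply/orP; left; apply/eqP; field.
by rewrite !gt_eqF.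
Qed.

End Iterates.

(** * Maximal and ergodic theorems for two commuting maps *)

Section ErgodicTheorem.
Variables S T : W -> W.
Hypotheses (pS : preserves B E S) (pT : preserves B E T).
Hypothesis comm : forall w, S (T w) = T (S w).

Lemma iter_comm i j w : iter i S (iter j T w) = iter j T (iter i S w).
Proof.
elim: i => //= i ->; elim: j => //= j <-; exact: comm.
Qed.

Lemma B_iter2 i j f : B f -> B (fun w => f (iter i S (iter j T w))).
Proof. by move=> Bf; apply: (B_iter pT j (f := fun w => f (iter i S w))); exact: B_iter. Qed.

Lemma E_iter2 i j f : B f -> E (fun w => f (iter i S (iter j T w))) = E f.
Proof.
move=> Bf; rewrite (E_iter pT j (f := fun w => f (iter i S w))) ?E_iter//.
exact: B_iter.
Qed.

Definition orbit_mean f N w := bmean N (fun i j => f (iter i S (iter j T w))).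

Lemma B_orbit_mean f N : B f -> B (orbit_mean f N).
Proof. by move=> Bf; apply: B_bmean => i j; exact: B_iter2. Qed.

Lemma E_orbit_mean f N : (0 < N)%N -> B f -> E (orbit_mean f N) = E f.
Proof.
move=> N0 Bf; rewrite (@E_bmean _ (fun i j w => f (iter i S (iter j T w)))) => [|i j].
  by rewrite -[RHS](bmean_cst _ N0); apply: eq_bmean => i j _ _; exact: E_iter2.
exact: B_iter2.
Qed.

(** [Q1] dominates the averages along [T], and [Q] those of [Q1] along [S]. The minimum with [1]
    gives [Q1 <= 1 + C], a bound that must be known before [d1] is chosen. *)
Lemma maximal_small2 C e : 0 < C -> 0 < e -> exists2 dl : R, 0 < dl &
  forall f, B f -> (forall w, 0 <= f w <= C) -> E f <= dl -> forall n,
  exists Q, [/\ B Q, E Q <= e & forall N w, (N <= n)%N -> orbit_mean f N w <= Q w].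
Proof.
move=> C0 e0.
have [d1 d10 max1] := maximal_small pS (addr_gt0 ltr01 C0) e0.
have d2 : 0 < Num.min d1 1 by rewrite lt_min d10 ltr01.
have [d2' d20 max2] := maximal_small pT C0 d2.
exists d2' => // f Bf fC Ef n.
have [Q1 [BQ1 Q1C EQ1 maxQ1]] := max2 f Bf fC Ef n.
have Q1C' w : 0 <= Q1 w <= 1 + C.
  by have /andP[-> O1w] := Q1C w; apply: le_trans O1w _; rewrite lerD2r ge_min lexx orbT.
have EQ1' : E Q1 <= d1 by apply: le_trans EQ1 _; rewrite ge_min lexx.
have [Q [BQ _ EQ maxQ]] := max1 Q1 BQ1 Q1C' EQ1' n.
exists Q; split=> // N w Nn; apply: le_trans (maxQ _ _ Nn).
apply: ler_cmean => i _; apply: le_trans (maxQ1 _ (iter i S w) Nn).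
by apply: ler_cmean => j _; rewrite iter_comm.
Qed.

Lemma maximal_small_sqr C e : 0 < C -> 0 < e -> exists2 dl : R, 0 < dl &
  forall f, B f -> (forall w, `|f w| <= C) -> E (fun w => f w ^+ 2) <= dl -> forall n,
  exists Q, [/\ B Q, E Q <= e &
    forall N w, (N <= n)%N -> orbit_mean (fun w => `|f w|) N w <= Q w].
Proof.
move=> C0 e0; have [dl dl0 max] := maximal_small2 C0 e0.
exists (dl ^+ 2); first by rewrite exprn_gt0.
move=> f Bf fC Ef; apply: max; [exact: B_norm|by move=> w; rewrite normr_ge0 fC|].
exact: E_norm_sqr.
Qed.

Lemma orbit_meanK f M N w : orbit_mean (orbit_mean f M) N w =
  bmean N (fun i j => bmean M (fun a b => f (iter (i + a) S (iter (j + b) T w)))).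
Proof.
apply: eq_bmean => i j _ _; apply: eq_bmean => a b _ _.
by rewrite -[in LHS]iter_comm -!iterD (addnC a) (addnC b).
Qed.

Lemma orbit_mean_close f g N w : `|orbit_mean f N w - orbit_mean g N w| <=
  orbit_mean (fun w => `|f w - g w|) N w.
Proof. by rewrite /orbit_mean -bmeanB; exact: ler_norm_bmean. Qed.

(* Almost invariant [h] such that [f - h] is almost a coboundary exist at every
   scale [s] and form convex sets, so by [conv_cauchy] one [h] is close in L2 to
   such functions at all larger scales; the maximal inequality does the rest. *)
Theorem ergodic_osc f e : B f -> 0 < e -> osc_le B E e (orbit_mean f).
Proof.
move=> Bf e0; have [C0 fC0] := (B_bnd mE) Bf.
have [C C1 fC] : exists2 C : R, 0 < C & forall w, `|f w| <= C.
  exists (1 + `|C0|) => [|w]; first by rewrite ltr_pwDl.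
  by apply: le_trans (fC0 w) _; apply: le_trans (ler_norm _) _; rewrite lerDr.
pose Cs (s : nat) h := [/\ B h, (forall w, `|h w| <= C),
  (forall N w, (0 < N <= s)%N -> `|orbit_mean h N w - h w| <= s.+1%:R^-1) &
  (forall r : R, 0 < r -> exists K, forall N w, (K <= N)%N ->
     `|orbit_mean f N w - orbit_mean h N w| <= r)].
(* The witness is [orbit_mean f J] with [J] much larger than [s]: averages of length at most [s]
   barely move it, and its averages of length much larger than [J] agree with those of [f]. *)
have Cne s : exists2 h, Cs s h & E (fun w => h w ^+ 2) <= C ^+ 2.
  have s1 : 0 < s.+1%:R^-1 :> R by rewrite invr_gt0.
  have [J J0 smallJ] := div_small (4 * C * s%:R) s1.
  have fwC w i j : `|f (iter i S (iter j T w))| <= C by exact: fC.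
  have hC w : `|orbit_mean f J w| <= C by apply: bmean_bound => //; exact: ltW.
  exists (orbit_mean f J); last first.
    apply: E_le_cst => [|w]; first by apply: (B_mul mE); exact: B_orbit_mean.
    by rewrite -[X in X ^+ 2]/(orbit_mean f J w) -real_normK ?num_real// lerXn2r ?nnegrE// ltW.
  split=> //; first exact: B_orbit_mean.
    move=> N w /andP[N0 Ns]; rewrite orbit_meanK.
    apply: le_trans (bmean_bmean J N0 (fwC w)) _.
    apply: le_trans (smallJ _ (leqnn J)); rewrite ler_wpM2r ?invr_ge0// ler_wpM2l ?ler_nat//.
    by rewrite mulr_ge0// ltW.
  move=> r r0; have [K K0 smallK] := div_small (4 * C * J%:R) r0.
  exists K => N w KN; rewrite orbit_meanK bmean_exchange distrC.
  apply: le_trans (smallK _ KN).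
  have := bmean_bmean N J0 (fwC w); congr (`|_ - _| <= _).
  by apply: eq_bmean => a b _ _; apply: eq_bmean => i j _ _; rewrite (addnC a) (addnC b).
have Cdec s s' h : (s <= s')%N -> Cs s' h -> Cs s h.
  move=> ss' [Bh hC inv cob]; split=> // N w /andP[N0 Ns].
  apply: le_trans (inv N w _) _; first by rewrite N0 (leq_trans Ns).
  by rewrite lef_pV2 ?posrE// ler_nat.
have CB s h : Cs s h -> B h by case.
have mid_mean h h' N w : orbit_mean (fun w => 2^-1 * (h w + h' w)) N w =
    2^-1 * (orbit_mean h N w + orbit_mean h' N w).
  by rewrite /orbit_mean bmeanZl bmeanD.
have mid (x y r : R) : `|x| <= r -> `|y| <= r -> `|2^-1 * (x + y)| <= r.
  by rewrite !ler_norml => /andP[? ?] /andP[? ?]; lra.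
have Cmid s h h' : Cs s h -> Cs s h' -> Cs s (fun w => 2^-1 * (h w + h' w)).
  move=> [Bh hC inv cob] [Bh' hC' inv' cob']; split.
  - by apply: B_scale; exact: (B_add mE).
  - by move=> w; exact: mid.
  - move=> N w Ns; rewrite mid_mean.
    have := mid _ _ _ (inv N w Ns) (inv' N w Ns); congr (`|_| <= _); ring.
  - move=> r r0; have [K smallK] := cob r r0; have [K' smallK'] := cob' r r0.
    exists (maxn K K') => N w; rewrite geq_max => /andP[KN KN']; rewrite mid_mean.
    by have := mid _ _ _ (smallK N w KN) (smallK' N w KN'); congr (`|_| <= _); field.
have e8 : 0 < e / 8 by lra.
have [dl dl0 maxdl] := maximal_small_sqr (C := 2 * C) (mulr_gt0 (ltr0Sn R 1) C1) e8.
have [s0 _ smalls0] := div_small 1 e8.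
have [s [s0s [h Ch nearh]]] := conv_cauchy Cne Cdec CB Cmid s0 dl0.
have [Bh hC _ cob] := Ch; have [K smallK] := cob _ e8.
(* [K] comes from [h] alone, whereas [h'], almost invariant up to length [n], may vary with [n]. The
   maximum with [1] excludes the empty average. *)
exists (maxn K 1) => n; have [h' Ch' hh'] := nearh (maxn s n).
have [Bh' hC' inv' _] := Ch'.
have hhC w : `|h w - h' w| <= 2 * C.
  by apply: le_trans (ler_normB _ _) _; have := hC w; have := hC' w; lra.
have [Q [BQ EQ maxQ]] := maxdl _ (B_sub Bh Bh') hhC hh' n.
exists (fun w => 2 * Q w + e / 2); split.
- by apply: (B_add mE) (B_cst mE _); exact: B_scale.
- rewrite (E_add mE (B_scale 2 BQ) (B_cst mE _)) (E_scale mE _ BQ) (E_cst mE); lra.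
have near N w : (maxn K 1 <= N <= n)%N -> `|orbit_mean f N w - h' w| <= Q w + e / 4.
  rewrite geq_max => /andP[/andP[KN N0] Nn].
  have a1 := smallK N w KN.
  have a2 := le_trans (orbit_mean_close h h' N w) (maxQ N w Nn).
  have a3 : `|orbit_mean h' N w - h' w| <= e / 8.
    apply: le_trans (inv' N w _) _; first by rewrite N0 leq_max Nn orbT.
    rewrite -div1r; apply: smalls0; apply: leq_trans s0s _.
    by apply: leq_trans (leq_maxl s n) _.
  by move: a1 a2 a3; rewrite !ler_norml => /andP[? ?] /andP[? ?] /andP[? ?]; lra.
move=> N N' w KN KN'; have := near N w KN; have := near N' w KN'.
by rewrite !ler_norml => /andP[? ?] /andP[? ?]; lra.
Qed.

End ErgodicTheorem.
End Mean.

(** * Limits of bounded sequences along an ultrafilter *)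

Section Ultralimits.
Variable R : realType.

Lemma ultra_cvg (U : set_system nat) (u : nat -> R) (C : R) : UltraFilter U ->
  (forall n, `|u n| <= C) -> cvg (u @ U).
Proof.
move=> UU uC.
have ultra : UltraFilter (u @ U).
  split=> [|G GF uG]; first exact: fmap_proper_filter.
  apply/seteqP; split => A; last exact: uG.
  move=> GA; have [//|UnA] := in_ultra_setVsetC (u @^-1` A) UU.
  have /uG GnA : (u @ U) (~` A) by [].
  by have [x []] := filter_ex (filterI GA GnA).
have := @segment_compact R (- C) C; rewrite compact_ultra => /(_ _ ultra).
case=> [|l [_ ul]]; last by apply/cvg_ex; exists l.
by apply: nearW => n; rewrite /= in_itv /= -ler_norml.
Qed.

Lemma exists_ultra : exists2 U : set_system nat, UltraFilter U & \oo `<=` U.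
Proof. by have [U [UU sU]] := ultraFilterLemma (F := \oo) _; exists U. Qed.

End Ultralimits.

(** * Oscillation bounds and selection of maximizers *)

Section OscLemmas.
Variables (R : realType) (W : Type) (B : (W -> R) -> Prop) (E : (W -> R) -> R).
Hypothesis mE : is_mean B E.

Lemma osc_le_trans (e e' : R) G : osc_le B E e G -> e <= e' -> osc_le B E e' G.
Proof.
move=> [K hosc] ee'; exists K => n; have [M [BM EM hM]] := hosc n.
by exists M; split=> //; exact: le_trans ee'.
Qed.

Lemma osc_le_add (e e' : R) G G' : osc_le B E e G -> osc_le B E e' G' ->
  osc_le B E (e + e') (fun N w => G N w + G' N w).
Proof.
move=> [K hosc] [K' hosc']; exists (maxn K K') => n.
have [M [BM EM hM]] := hosc n; have [M' [BM' EM' hM']] := hosc' n.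
exists (fun w => M w + M' w); split; first exact: (B_add mE).
  by rewrite (E_add mE)// lerD.
move=> N N' w; rewrite !geq_max => /andP[/andP[a a'] b] /andP[/andP[c c'] d].
rewrite opprD addrACA; apply: le_trans (ler_normD _ _) _.
by apply: lerD; [apply: hM|apply: hM']; apply/andP.
Qed.

Lemma osc_le_scale (c e : R) G : osc_le B E e G ->
  osc_le B E (`|c| * e) (fun N w => c * G N w).
Proof.
move=> [K hosc]; exists K => n; have [M [BM EM hM]] := hosc n.
exists (fun w => `|c| * M w); split; first exact: (B_scale mE).
  by rewrite (E_scale mE)// ler_wpM2l.
by move=> N N' w KN KN'; rewrite -mulrBr normrM ler_wpM2l// hM.
Qed.

(** Candidates are added one at a time: [B_pos] puts into [B] the indicator of the set where the new
    one wins, so [B] is closed under the case distinction. The clause on [psi] says that [s] is a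
    simple function measurable with respect to [B]. *)
Lemma selection (I : Type) (phi : I -> W -> R) (i0 : I) (l : seq I) :
  (forall i, B (phi i)) -> exists s : W -> I,
  [/\ forall w, List.Forall (fun i => phi i w <= phi (s w) w) (i0 :: l),
      forall psi : I -> R, B (fun w => psi (s w)) & B (fun w => phi (s w) w)].
Proof.
move=> Bphi; elim: l => [|i l [s [smax Bpsi Bs]]].
  exists (fun=> i0); split=> [w|psi|].
  - by constructor => //; constructor.
  - exact: (B_cst mE).
  - exact: Bphi.
pose s' w := if phi (s w) w < phi i w then i else s w.
have BP := B_pos mE (B_sub mE (Bphi i) Bs).
have Bif f g : B f -> B g -> B (fun w => if phi (s w) w < phi i w then f w else g w).
  move=> Bf Bg; have := B_add mE Bg (B_mul mE BP (B_sub mE Bf Bg)); congr B.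
  apply/funext => w; rewrite subr_gt0; case: ifP => _; last by rewrite mul0r addr0.
  by rewrite mul1r addrC subrK.
exists s'; split.
- move=> w; have := smax w => /List.Forall_cons_iff[h0 hl].
  have le : phi (s w) w <= phi (s' w) w by rewrite /s'; case: ifP => // /ltW.
  have lei : phi i w <= phi (s' w) w by rewrite /s'; case: ltP.
  constructor; first exact: le_trans le.
  by constructor=> //; apply: List.Forall_impl hl => j jw; exact: le_trans le.
- move=> psi; have := Bif _ _ (B_cst mE (psi i)) (Bpsi psi); congr B.
  by apply/funext => w; rewrite /s'; case: ifP.
- have := Bif _ _ (Bphi i) Bs; congr B.
  by apply/funext => w; rewrite /s'; case: ifP.
Qed.

End OscLemmas.

(** * Sign vectors maximizing a bilinear form *)

Section Signs.
Variables (R : realType) (h : nat).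
Implicit Types (s t : {ffun 'I_h.+1 -> bool}).

(** Sign vectors on [h.+1] indices form a finite type, over which [selection] can maximize; [inord]
    turns them into sequences on [nat]. *)
Definition sgn_of s (a : nat) : R := (-1) ^+ s (inord a).

Lemma norm_sgn_of s a : `|sgn_of s a| = 1.
Proof. by rewrite /sgn_of normr_sign. Qed.

Lemma cmean_sgn_max (p c : nat -> R) : (forall a, `|p a| <= 1) ->
  exists s, cmean h.+1 (fun a => p a * c a) <= cmean h.+1 (fun a => sgn_of s a * c a).
Proof.
move=> p1; exists [ffun a : 'I_h.+1 => c a < 0]; apply: ler_cmean => a ah.
rewrite /sgn_of ffunE inordK// -normrEsign.
apply: le_trans (ler_norm _) _; rewrite normrM.
by rewrite -[leRHS]mul1r ler_wpM2r.
Qed.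

(** A bilinear form on a product of cubes is maximal at vertices: replace one vector by signs with
    the other fixed, then exchange the roles. The absolute value is absorbed into the sign of
    [p]. *)
Lemma bmean_sgn_max (p q : nat -> R) (c : nat -> nat -> R) :
  (forall a, `|p a| <= 1) -> (forall b, `|q b| <= 1) -> exists s t,
  `|bmean h.+1 (fun a b => p a * q b * c a b)| <=
  bmean h.+1 (fun a b => sgn_of s a * sgn_of t b * c a b).
Proof.
move=> p1 q1.
have [r [r1 ->]] : exists r : nat -> R, (forall a, `|r a| <= 1) /\
    `|bmean h.+1 (fun a b => p a * q b * c a b)| = bmean h.+1 (fun a b => r a * q b * c a b).
  case: (ger0P (bmean h.+1 (fun a b => p a * q b * c a b))) => _; first by exists p.
  exists (fun a => - p a); split=> [a|]; first by rewrite normrN.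
  by rewrite -mulN1r -bmeanZl; apply: eq_bmean => a b _ _; ring.
have [s les] := cmean_sgn_max (fun a => cmean h.+1 (fun b => q b * c a b)) r1.
have [t let_] := cmean_sgn_max (fun b => cmean h.+1 (fun a => sgn_of s a * c a b)) q1.
exists s, t.
have -> : bmean h.+1 (fun a b => r a * q b * c a b) =
    cmean h.+1 (fun a => r a * cmean h.+1 (fun b => q b * c a b)).
  by apply: eq_cmean => a _; rewrite -cmeanZl; apply: eq_cmean => b _; rewrite mulrA.
apply: (le_trans les).
have -> : cmean h.+1 (fun a => sgn_of s a * cmean h.+1 (fun b => q b * c a b)) =
    cmean h.+1 (fun b => q b * cmean h.+1 (fun a => sgn_of s a * c a b)).
  under eq_cmean do rewrite -cmeanZl.
  rewrite cmean_exchange; apply: eq_cmean => b _; rewrite -cmeanZl.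
  by apply: eq_cmean => a _; ring.
apply: (le_trans let_); under eq_cmean do rewrite -cmeanZl.
rewrite cmean_exchange le_eqVlt; apply/orP; left; apply/eqP.
by apply: eq_cmean => a _; apply: eq_cmean => b _; ring.
Qed.

End Signs.

(** * Cut norms and their dual functions *)

Section BilinearAverages.
Variables (R : realType) (W : Type) (B : (W -> R) -> Prop) (E : (W -> R) -> R).
Hypothesis mE : is_mean B E.
Variables (S T S' T' : W -> W).
Hypotheses (pS : preserves B E S) (pT : preserves B E T).
Hypotheses (pS' : preserves B E S') (pT' : preserves B E T').
Hypotheses (SK : cancel S S') (S'K : cancel S' S) (TK : cancel T T') (T'K : cancel T' T).
Hypothesis comm : forall w, S (T w) = T (S w).
Variables f1 f2 : W -> R.
Hypotheses (f1_le1 : forall w, `|f1 w| <= 1) (f2_le1 : forall w, `|f2 w| <= 1).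

Definition avg12 (f : W -> R) N w : R :=
  bmean N (fun i j => f1 (iter i S w) * f2 (iter j T w) * f (iter i S (iter j T w))).

Lemma avg12D f g N w : avg12 (fun w => f w + g w) N w = avg12 f N w + avg12 g N w.
Proof. by rewrite /avg12 -bmeanD; apply: eq_bmean => i j _ _; rewrite mulrDr. Qed.

Lemma avg12Z c f N w : avg12 (fun w => c * f w) N w = c * avg12 f N w.
Proof. by rewrite /avg12 -bmeanZl; apply: eq_bmean => i j _ _; ring. Qed.

Lemma ler_norm_prod12 w w' (x : R) : `|f1 w * f2 w' * x| <= `|x|.
Proof.
rewrite !normrM -[leRHS]mul1r ler_wpM2r// -[leRHS]mulr1.
by apply: ler_pM.
Qed.

Lemma avg12_close f g N w :
  `|avg12 f N w - avg12 g N w| <= orbit_mean S T (fun w => `|f w - g w|) N w.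
Proof.
rewrite /avg12 -bmeanB; apply: le_trans (ler_norm_bmean _ _) _.
by apply: ler_bmean => i j _ _; rewrite -mulrBr; exact: ler_norm_prod12.
Qed.

(* [k w] is the cut norm of the array [g (S^a T^b w)], [a, b <= h], attained by
   the sign vectors [u _ w] and [v _ w]. *)
Record cut_norm (g : W -> R) h (u v : nat -> W -> R) (k : W -> R) : Prop := CutNorm {
  cut_Bu : forall a, B (u a) ;
  cut_Bv : forall b, B (v b) ;
  cut_u1 : forall a w, `|u a w| <= 1 ;
  cut_v1 : forall b w, `|v b w| <= 1 ;
  cut_def : forall w, k w =
    bmean h.+1 (fun a b => u a w * v b w * g (iter a S (iter b T w))) ;
  cut_max : forall (p q : nat -> R) w, (forall a, `|p a| <= 1) -> (forall b, `|q b| <= 1) ->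
    `|bmean h.+1 (fun a b => p a * q b * g (iter a S (iter b T w)))| <= k w }.

(** The maximum over the finitely many pairs of sign vectors is selected within [B]; [bmean_sgn_max]
    then covers all bounded vectors. *)
Lemma exists_cut_norm g h : B g -> exists u v k, cut_norm g h u v k.
Proof.
move=> Bg.
pose I := ({ffun 'I_h.+1 -> bool} * {ffun 'I_h.+1 -> bool})%type.
pose phi (i : I) w := bmean h.+1 (fun a b =>
  sgn_of R i.1 a * sgn_of R i.2 b * g (iter a S (iter b T w))).
have Bphi i : B (phi i).
  apply: (B_bmean mE h.+1 (F := fun a b w =>
    sgn_of R i.1 a * sgn_of R i.2 b * g (iter a S (iter b T w)))) => a b.
  by apply: (B_scale mE); exact: (B_iter2 pS pT).
pose l := enum {: {ffun 'I_h.+1 -> bool} * {ffun 'I_h.+1 -> bool}}.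
have [s [smax Bpsi Bs]] := selection mE ([ffun=> true], [ffun=> true]) l Bphi.
exists (fun a w => sgn_of R (s w).1 a), (fun b w => sgn_of R (s w).2 b), (fun w => phi (s w) w).
split=> //.
- by move=> a; exact: (Bpsi (fun i => sgn_of R i.1 a)).
- by move=> b; exact: (Bpsi (fun i => sgn_of R i.2 b)).
- by move=> a w; rewrite norm_sgn_of.
- by move=> b w; rewrite norm_sgn_of.
move=> p q w p1 q1.
have [t [t' le]] := bmean_sgn_max h (fun a b => g (iter a S (iter b T w))) p1 q1.
apply: (le_trans le); have /List.Forall_cons_iff[_] := smax w.
move=> /List.Forall_forall/(_ (t, t')); apply.
have : (t, t') \in l by rewrite mem_enum.
elim: l {smax} => //= i l IH; rewrite in_cons => /orP[/eqP ->|/IH]; [by left|by right].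
Qed.

Section CutNorm.
Variables (g : W -> R) (h : nat) (u v : nat -> W -> R) (k : W -> R).
Hypotheses (Bg : B g) (ck : cut_norm g h u v k).

Lemma B_cut : B k.
Proof.
have := B_bmean mE h.+1 (F := fun a b w => u a w * v b w * g (iter a S (iter b T w))).
rewrite (_ : (fun w => _) = k); first apply.
  move=> a b; apply: (B_mul mE); last exact: (B_iter2 pS pT).
  by apply: (B_mul mE); [exact: cut_Bu ck _|exact: cut_Bv ck _].
by apply/funext => w; rewrite (cut_def ck).
Qed.

(** The average is regrouped over all translates of a box of side [h.+1]. On the box at [(i, j)] the
    weight from [f1] depends only on [a] and that from [f2] only on [b], so the cut norm at its base
    point bounds the box. *)
Lemma avg12_le_cut C N w : (forall w, `|g w| <= C) ->
  `|avg12 g N w| <= orbit_mean S T k N w + 4 * C * h.+1%:R / N%:R.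
Proof.
move=> gC.
pose c i j := f1 (iter i S w) * f2 (iter j T w) * g (iter i S (iter j T w)).
have cC i j : `|c i j| <= C by apply: le_trans (ler_norm_prod12 _ _ _) (gC _).
have close := bmean_bmean N (ltn0Sn h) cC.
have le : `|bmean h.+1 (fun a b => bmean N (fun i j => c (a + i)%N (b + j)%N))| <=
    orbit_mean S T k N w.
  rewrite bmean_exchange; apply: le_trans (ler_norm_bmean _ _) _.
  apply: ler_bmean => i j _ _.
  have := cut_max ck (iter i S (iter j T w)) (fun a => f1_le1 (iter (a + i) S w))
    (fun b => f2_le1 (iter (b + j) T w)).
  congr (`|_| <= _); apply: eq_bmean => a b _ _; rewrite /c; congr (_ * g _).
  by rewrite -(iter_comm comm) -!iterD.
move: close le; rewrite -/(bmean N c) /avg12 -/c !ler_norml.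
by move=> /andP[? ?] /andP[? ?]; lra.
Qed.

Lemma osc_le_cut (e : R) : 0 < e -> osc_le B E (2 * E k + e) (avg12 g).
Proof.
move=> e0; have [C gC] := B_bnd mE Bg.
have e8 : 0 < e / 8 by lra.
have Bk := B_cut.
have [K hosc] := ergodic_osc mE pS pT comm Bk e8.
have [K' K'0 smallK'] := div_small (4 * C * h.+1%:R) e8.
pose K2 := maxn K K'; have K20 : (0 < K2)%N by rewrite leq_max K'0 orbT.
(* [K2] is a reference time, at which the orbit mean of [k] has mean [E k]; the window is enlarged
   to [maxn K2 n] so that it contains [K2] even when [n < K2]. *)
exists K2 => n; have [M [BM EM hM]] := hosc (maxn K2 n).
have Bo := B_orbit_mean mE pS pT K2 Bk.
have Bo2 := B_add mE Bo BM.
exists (fun w => 2 * (orbit_mean S T k K2 w + M w) + e / 4); split.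
- by apply: (B_add mE) (B_cst mE _); exact: (B_scale mE).
- rewrite (E_add mE (B_scale mE 2 Bo2) (B_cst mE _)) (E_scale mE _ Bo2) (E_cst mE).
  by rewrite (E_add mE Bo BM) (E_orbit_mean mE pS pT)//; lra.
have bd N w : (K2 <= N <= n)%N ->
    `|avg12 g N w| <= orbit_mean S T k K2 w + M w + e / 8.
  move=> /andP[KN Nn]; have := avg12_le_cut N w gC.
  have := smallK' N (leq_trans (leq_maxr _ _) KN).
  have : `|orbit_mean S T k N w - orbit_mean S T k K2 w| <= M w.
    apply: hM; rewrite leq_max.
      by rewrite Nn orbT andbT (leq_trans (leq_maxl _ _) KN).
    by rewrite leqnn leq_maxl.
  by rewrite !ler_norml => /andP[? ?] ? /andP[? ?]; lra.
move=> N N' w KN KN'; apply: le_trans (ler_normB _ _) _.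
by have := bd _ w KN; have := bd _ w KN'; lra.
Qed.

Definition pull a b w := iter a S' (iter b T' w).

(** The adjoint form of [k]: the substitution [x = S^a T^b w] moves [g] to [x] and the weights to
    the pullback of [x]. *)
Definition cut_dual w := bmean h.+1 (fun a b => u a (pull a b w) * v b (pull a b w)).

Lemma comm_S'T w : S' (T w) = T (S' w).
Proof. by rewrite -[in LHS](S'K w) -comm SK. Qed.

Lemma comm_ST' w : S (T' w) = T' (S w).
Proof. by rewrite -[in RHS](T'K w) comm TK. Qed.

Lemma iterSK i w : iter i S' (iter i S w) = w.
Proof. by elim: i w => // i IH w; rewrite iterSr iterS SK IH. Qed.

Lemma iterTK i w : iter i T' (iter i T w) = w.
Proof. by elim: i w => // i IH w; rewrite iterSr iterS TK IH. Qed.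

Lemma iterS'K i w : iter i S (iter i S' w) = w.
Proof. by elim: i w => // i IH w; rewrite iterSr iterS S'K IH. Qed.

Lemma iterT'K i w : iter i T (iter i T' w) = w.
Proof. by elim: i w => // i IH w; rewrite iterSr iterS T'K IH. Qed.

Lemma pullK a b w : pull a b (iter a S (iter b T w)) = w.
Proof. by rewrite /pull -(iter_comm comm_ST') iterSK iterTK. Qed.

Lemma pull_shift a b i j w :
  pull (i + a) (j + b) (iter i S (iter j T w)) = pull a b w.
Proof.
rewrite /pull (addnC i) (addnC j) !iterD -(iter_comm comm_ST').
by rewrite -(iter_comm comm_ST') iterSK iterTK.
Qed.

Lemma iter_pull a b w : iter a S (iter b T (pull a b w)) = w.
Proof. by rewrite /pull -(iter_comm comm_S'T) iterS'K iterT'K. Qed.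

Lemma B_pull a b f : B f -> B (fun w => f (pull a b w)).
Proof. by move=> Bf; exact: (B_iter2 pS' pT'). Qed.

Lemma B_cut_dual : B cut_dual.
Proof.
apply: (B_bmean mE h.+1 (F := fun a b w => u a (pull a b w) * v b (pull a b w))) => a b.
by apply: (B_mul mE); apply: B_pull; [exact: cut_Bu ck _|exact: cut_Bv ck _].
Qed.

Lemma cut_dual_le1 w : `|cut_dual w| <= 1.
Proof.
apply: bmean_bound => // a b _ _; rewrite normrM -[leRHS]mulr1.
by apply: ler_pM => //; [exact: cut_u1 ck _ _|exact: cut_v1 ck _ _].
Qed.

(** Change of variables in each cell: composing with [S^a T^b] preserves [E] and cancels
    [pull a b]. *)
Lemma E_cut_dual : E (fun w => g w * cut_dual w) = E k.
Proof.
have Bu := cut_Bu ck; have Bv := cut_Bv ck.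
have BF a b : B (fun w => u a w * v b w * g (iter a S (iter b T w))).
  by apply: (B_mul mE); [exact: (B_mul mE)|exact: (B_iter2 pS pT)].
have BG a b : B (fun w => g w * (u a (pull a b w) * v b (pull a b w))).
  by apply: (B_mul mE) => //; apply: (B_mul mE); exact: B_pull.
have -> : (fun w => g w * cut_dual w) = (fun w => bmean h.+1 (fun a b =>
    g w * (u a (pull a b w) * v b (pull a b w)))).
  by apply/funext => w; rewrite -bmeanZl.
rewrite (E_bmean mE _ BG).
have -> : k = fun w => bmean h.+1 (fun a b => u a w * v b w * g (iter a S (iter b T w))).
  by apply/funext => w; rewrite (cut_def ck).
rewrite (E_bmean mE _ BF); apply: eq_bmean => a b _ _.
rewrite -(E_iter2 pS pT a b (BG a b)); congr E; apply/funext => w.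
by rewrite pullK mulrC.
Qed.

(** At [S^i T^j w] the box of the dual is shifted by [(i, j)], at cost [4 * N / (h + 1)]. By
    [pull_shift] the pullback then no longer depends on [(i, j)], and for fixed [(a, b)] the summand
    is a function of [i] times a function of [j]. *)
Lemma avg12_cut_dual N w : (0 < N)%N -> `|avg12 cut_dual N w - bmean h.+1 (fun a b =>
    bmean N (fun i _ => f1 (iter (a + i) S (iter b T (pull a b w))) * u (a + i)%N (pull a b w)) *
    bmean N (fun _ j => f2 (iter a S (iter (b + j) T (pull a b w))) * v (b + j)%N (pull a b w)))|
  <= 4 * N%:R / h.+1%:R.
Proof.
move=> N0.
have -> : bmean h.+1 (fun a b =>
    bmean N (fun i _ => f1 (iter (a + i) S (iter b T (pull a b w))) * u (a + i)%N (pull a b w)) *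
    bmean N (fun _ j => f2 (iter a S (iter (b + j) T (pull a b w))) * v (b + j)%N (pull a b w))) =
  bmean N (fun i j => f1 (iter i S w) * f2 (iter j T w) *
    bmean h.+1 (fun a b => u (a + i)%N (pull a b w) * v (b + j)%N (pull a b w))).
  transitivity (bmean h.+1 (fun a b => bmean N (fun i j => f1 (iter i S w) * f2 (iter j T w) *
    (u (a + i)%N (pull a b w) * v (b + j)%N (pull a b w))))).
    apply: eq_bmean => a b _ _; rewrite -bmeanM; apply: eq_bmean => i j _ _.
    have -> : iter (a + i) S (iter b T (pull a b w)) = iter i S w.
      by rewrite addnC iterD iter_pull.
    have -> : iter a S (iter (b + j) T (pull a b w)) = iter j T w.
      by rewrite addnC iterD (iter_comm comm) iter_pull.
    by ring.
  by rewrite bmean_exchange; apply: eq_bmean => i j _ _; rewrite bmeanZl.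
rewrite /avg12 -bmeanB; apply: bmean_bound => [|i j iN jN]; first by rewrite divr_ge0.
rewrite -mulrBr; apply: le_trans (ler_norm_prod12 _ _ _) _.
pose z := iter i S (iter j T w).
pose c a b := u a (pull a b z) * v b (pull a b z).
have c1 a b : `|c a b| <= 1.
  rewrite normrM -[leRHS]mulr1.
  by apply: ler_pM => //; [exact: cut_u1 ck _ _|exact: cut_v1 ck _ _].
have := bmean_shift h.+1 i j c1; rewrite distrC => sh.
have -> : bmean h.+1 (fun a b => u (a + i)%N (pull a b w) * v (b + j)%N (pull a b w)) =
    bmean h.+1 (fun a b => c (i + a)%N (j + b)%N).
  by apply: eq_bmean => a b _ _; rewrite /c /z pull_shift (addnC a) (addnC b).
apply: (le_trans sh); rewrite ler_wpM2r ?invr_ge0// mulr1.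
have : (i + j)%:R <= 2 * N%:R :> R by rewrite -natrM ler_nat; lia.
lra.
Qed.

End CutNorm.
End BilinearAverages.

(** * An ultralimit mean on growing grids *)

Section GridMean.
Variables (R : realType) (W : Type) (B : (W -> R) -> Prop) (E : (W -> R) -> R).
Hypothesis mE : is_mean B E.
Variable U : set_system nat.
Hypotheses (UU : UltraFilter U) (sU : \oo `<=` U).

(* [(w, (h, (a, b)))] is the point [w] in the cell [(a, b)] of the grid [0, h]^2. *)
Definition gridT := (W * (nat * (nat * nat)))%type.
Implicit Types (F G : gridT -> R).

Definition B_grid F : Prop :=
  (forall i, B (fun w => F (w, i))) /\ exists C, forall z, `|F z| <= C.

(** Only cells with [a, b <= h] carry weight; the type contains all cells so that the shifts are
    total maps. *)
Definition level_mean F (h : nat) : R :=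
  bmean h.+1 (fun a b => E (fun w => F (w, (h, (a, b))))).

Definition grid_mean F : R := lim (level_mean F @ U).

Lemma level_mean_cvg F : B_grid F -> level_mean F @ U --> grid_mean F.
Proof.
move=> [BF [C FC]]; apply: (@ultra_cvg _ _ _ `|C|) => h.
apply: bmean_bound => // a b _ _; apply: (E_norm_le mE) => // w.
by apply: le_trans (FC _) _; exact: ler_norm.
Qed.

Lemma grid_mean_lim F (l : R) : level_mean F @ U --> l -> grid_mean F = l.
Proof. by move=> Fl; exact: (cvg_lim (@norm_hausdorff _ _) Fl). Qed.

Lemma grid_is_mean : is_mean B_grid grid_mean.
Proof.
split.
- by move=> c; split=> [i|]; [exact: (B_cst mE)|exists `|c|].
- move=> F G [BF [C FC]] [BG [D GD]]; split=> [i|]; first exact: (B_add mE).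
  by exists (C + D) => z; apply: le_trans (ler_normD _ _) _; exact: lerD.
- move=> F G [BF [C FC]] [BG [D GD]]; split=> [i|]; first exact: (B_mul mE).
  by exists (C * D) => z; rewrite normrM; exact: ler_pM.
- move=> F [BF _]; split=> [i|]; first exact: (B_pos mE).
  by exists 1 => z; case: ltP => _; rewrite ?normr1 ?normr0.
- by move=> F [_ FC].
- move=> c; apply: grid_mean_lim.
  have -> : level_mean (fun=> c) = fun=> c.
    apply/funext => h; rewrite -[RHS](bmean_cst c (ltn0Sn h)).
    by apply: eq_bmean => a b _ _; rewrite (E_cst mE).
  exact: cvg_cst.
- move=> F G bF bG; apply: grid_mean_lim.
  have -> : level_mean (fun z => F z + G z) = level_mean F \+ level_mean G.
    apply/funext => h /=; rewrite /level_mean -bmeanD.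
    by apply: eq_bmean => a b _ _; rewrite (E_add mE) ?bF.1 ?bG.1//; [exact: bF.1|exact: bG.1].
  by apply: cvgD; exact: level_mean_cvg.
- move=> c F bF; apply: grid_mean_lim.
  have -> : level_mean (fun z => c * F z) = (fun h => c * level_mean F h).
    apply/funext => h /=; rewrite /level_mean -bmeanZl.
    by apply: eq_bmean => a b _ _; rewrite (E_scale mE)//; exact: bF.1.
  by apply: cvgM; [exact: cvg_cst|exact: level_mean_cvg].
- move=> F G bF bG FG; apply: (ler_cvg_to (level_mean_cvg bF) (level_mean_cvg bG)).
  apply: nearW => h; apply: ler_bmean => a b _ _.
  by apply: (E_le mE) => [||w]; [exact: bF.1|exact: bG.1|exact: FG].
Qed.

Definition grid_shift (s t : nat) (z : gridT) : gridT :=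
  (z.1, (z.2.1, ((s + z.2.2.1)%N, (t + z.2.2.2)%N))).

(** At level [h] a shift changes the mean by a boundary term of order [(s + t) / (h + 1)], which
    disappears in the limit along [U]. *)
Lemma preserves_grid_shift s t : preserves B_grid grid_mean (grid_shift s t).
Proof.
move=> F bF; have [BF [C FC]] := bF.
have bFs : B_grid (fun z => F (grid_shift s t z)).
  by split=> [[h [a b]]|]; [exact: (BF (h, ((s + a)%N, (t + b)%N)))|exists C].
split=> //; apply: grid_mean_lim.
have -> : level_mean (fun z => F (grid_shift s t z)) = (fun h => level_mean F h +
   (level_mean (fun z => F (grid_shift s t z)) h - level_mean F h)).
  by apply/funext => h; rewrite addrC subrK.
rewrite -[grid_mean F]addr0; apply: cvgD; first exact: level_mean_cvg.
apply/cvgrPdist_le => e e0; apply: sU.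
have [K K0 smallK] := div_small (2 * C * (s + t)%:R) e0.
exists K => // h /= Kh; rewrite sub0r normrN.
apply: le_trans (smallK h.+1 (leqW Kh)).
apply: (bmean_shift h.+1 (c := fun a b => E (fun w => F (w, (h, (a, b)))))).
by move=> a b; exact: (E_norm_le mE).
Qed.

Lemma iter_grid_shift_l i w h a b :
  iter i (grid_shift 1 0) (w, (h, (a, b))) = (w, (h, ((a + i)%N, b))).
Proof. by elim: i => [|i /= ->]; rewrite ?addn0// /grid_shift /= add0n add1n addnS. Qed.

Lemma iter_grid_shift_r i w h a b :
  iter i (grid_shift 0 1) (w, (h, (a, b))) = (w, (h, (a, (b + i)%N))).
Proof. by elim: i => [|i /= ->]; rewrite ?addn0// /grid_shift /= add0n add1n addnS. Qed.

(** With the identity as one of its two maps, [orbit_mean] becomes a one-parameter average. *)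
Lemma preserves_id : preserves B_grid grid_mean id.
Proof. by []. Qed.

End GridMean.

Lemma iter_id (T : Type) n (x : T) : iter n id x = x.
Proof. by elim: n. Qed.

Lemma sqr_le1 (R : realDomainType) (x : R) : `|x| <= 1 -> x ^+ 2 <= 1.
Proof. by move=> x1; rewrite -[x ^+ 2]real_normK ?num_real// expr_le1. Qed.

(** * Oscillation of the bilinear averages *)

Section StructuredApproximation.
Variables (R : realType) (W : Type) (B : (W -> R) -> Prop) (E : (W -> R) -> R).
Hypothesis mE : is_mean B E.
Variables (S T S' T' : W -> W).
Hypotheses (pS : preserves B E S) (pT : preserves B E T).
Hypotheses (pS' : preserves B E S') (pT' : preserves B E T').
Hypotheses (SK : cancel S S') (S'K : cancel S' S) (TK : cancel T T') (T'K : cancel T' T).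
Hypothesis comm : forall w, S (T w) = T (S w).
Variables f1 f2 : W -> R.
Hypotheses (Bf1 : B f1) (Bf2 : B f2).
Hypotheses (f1_le1 : forall w, `|f1 w| <= 1) (f2_le1 : forall w, `|f2 w| <= 1).
Local Notation avg := (avg12 S T f1 f2).

Section Grid.
Variables (g : W -> R) (u v : nat -> nat -> W -> R) (k : nat -> W -> R).
Hypothesis ck : forall h, cut_norm B S T g h (u h) (v h) (k h).
Variable U : set_system nat.
Hypotheses (UU : UltraFilter U) (sU : \oo `<=` U).
Local Notation D h := (cut_dual S' T' h (u h) (v h)).

(* A grid point [(w, (h, (a, b)))] encodes [x = S^a T^b w] with its pullback [w];
   moving [x] along [S] while keeping [w] fixed is the shift of [a]. *)
Definition row_fun (z : gridT W) : R :=
  f1 (iter z.2.2.1 S (iter z.2.2.2 T z.1)) * u z.2.1 z.2.2.1 z.1.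

Definition col_fun (z : gridT W) : R :=
  f2 (iter z.2.2.1 S (iter z.2.2.2 T z.1)) * v z.2.1 z.2.2.2 z.1.

Lemma row_fun_le1 z : `|row_fun z| <= 1.
Proof. by rewrite normrM -[leRHS]mulr1; apply: ler_pM => //; exact: cut_u1 (ck _) _ _. Qed.

Lemma col_fun_le1 z : `|col_fun z| <= 1.
Proof. by rewrite normrM -[leRHS]mulr1; apply: ler_pM => //; exact: cut_v1 (ck _) _ _. Qed.

Lemma B_row_fun : B_grid B row_fun.
Proof.
split=> [[h [a b]]|]; last by exists 1; exact: row_fun_le1.
by apply: (B_mul mE); [exact: (B_iter2 pS pT)|exact: cut_Bu (ck h) _].
Qed.

Lemma B_col_fun : B_grid B col_fun.
Proof.
split=> [[h [a b]]|]; last by exists 1; exact: col_fun_le1.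
by apply: (B_mul mE); [exact: (B_iter2 pS pT)|exact: cut_Bv (ck h) _].
Qed.

Definition row_mean := orbit_mean (grid_shift 1 0) id row_fun.
Definition col_mean := orbit_mean id (grid_shift 0 1) col_fun.

Lemma row_mean_le1 N z : `|row_mean N z| <= 1.
Proof. by apply: bmean_bound => // i j _ _; exact: row_fun_le1. Qed.

Lemma col_mean_le1 N z : `|col_mean N z| <= 1.
Proof. by apply: bmean_bound => // i j _ _; exact: col_fun_le1. Qed.

Lemma avg_cut_dual N h w : (0 < N)%N -> `|avg (D h) N w - bmean h.+1 (fun a b =>
    row_mean N (pull S' T' a b w, (h, (a, b))) * col_mean N (pull S' T' a b w, (h, (a, b))))|
  <= 4 * N%:R / h.+1%:R.
Proof.
move=> N0; apply: le_trans (avg12_cut_dual SK S'K TK T'K comm f1_le1 f2_le1 (ck h) w N0).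
rewrite le_eqVlt; apply/orP; left; apply/eqP; congr `|_ - _|.
apply: eq_bmean => a b _ _; congr (_ * _); apply: eq_bmean => i j _ _.
- by rewrite iter_id iter_grid_shift_l.
- by rewrite iter_id iter_grid_shift_r.
Qed.

(** [K] comes from the ergodic theorem for [grid_mean], hence depends on neither [n] nor [h]. For
    fixed [n] and [U]-almost all [h], the level mean of the dominating function [Q0] is near its
    ultralimit and the error [4 * n / (h + 1)] is small; averaging the pullbacks of [Q0] over the
    cells gives [Q]. *)
Lemma osc_cut_dual (e : R) : 0 < e -> exists K, forall n, U [set h |
  exists Q, [/\ B Q, E Q <= e & forall N N' w, (K <= N <= n)%N -> (K <= N' <= n)%N ->
    `|avg (D h) N w - avg (D h) N' w| <= Q w]].
Proof.
move=> e0; have e8 : 0 < e / 8 by lra.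
have mG := grid_is_mean mE UU.
have pl := preserves_grid_shift mE UU sU 1 0; have pr := preserves_grid_shift mE UU sU 0 1.
have pid := @preserves_id _ _ B E U.
have [K1 hosc1] := ergodic_osc mG pl pid (fun=> erefl) B_row_fun e8.
have [K2 hosc2] := ergodic_osc mG pid pr (fun=> erefl) B_col_fun e8.
exists (maxn 1 (maxn K1 K2)) => n.
have [Q1 [BQ1 EQ1 hQ1]] := hosc1 n; have [Q2 [BQ2 EQ2 hQ2]] := hosc2 n.
pose Q0 z := Q1 z + Q2 z.
have BQ0 : B_grid B Q0 by exact: (B_add mG).
have EQ0 : grid_mean E U Q0 <= e / 4 by rewrite (E_add mG)//; lra.
have /cvgrPdist_le/(_ _ e8) near1 := level_mean_cvg mE UU BQ0.
have [H H0 smallH] := div_small (4 * n%:R) e8.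
have near2 : \forall h \near U, (H <= h)%N by apply: sU; exists H.
apply: filterS (filterI near1 near2) => h [/= close Hh].
pose p a b w := Q0 (pull S' T' a b w, (h, (a, b))).
have Bp a b : B (p a b).
  by apply: (B_pull pS' pT' a b (f := fun y => Q0 (y, (h, (a, b))))); exact: BQ0.1.
have BQ : B (fun w => bmean h.+1 (fun a b => p a b w)) by exact: (B_bmean mE).
exists (fun w => bmean h.+1 (fun a b => p a b w) + e / 4); split.
- by apply: (B_add mE) => //; exact: (B_cst mE).
- rewrite (E_add mE BQ (B_cst mE _)) (E_cst mE) (E_bmean mE _ Bp).
  suff -> : bmean h.+1 (fun a b => E (p a b)) = level_mean E Q0 h.
    by move: close; rewrite ler_norml => /andP[? ?]; lra.
  apply: eq_bmean => a b _ _.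
  by rewrite (E_iter2 pS' pT' a b (f := fun y => Q0 (y, (h, (a, b)))))//; exact: BQ0.1.
have err N w : (maxn 1 (maxn K1 K2) <= N <= n)%N -> `|avg (D h) N w - bmean h.+1 (fun a b =>
    row_mean N (pull S' T' a b w, (h, (a, b))) * col_mean N (pull S' T' a b w, (h, (a, b))))|
    <= e / 8.
  rewrite geq_max => /andP[/andP[N0 _] Nn].
  apply: le_trans (avg_cut_dual h w N0) _; apply: le_trans (smallH h.+1 (leqW Hh)).
  by rewrite ler_wpM2r ?invr_ge0// ler_wpM2l// ler_nat.
move=> N N' w KN KN'; have := err N w KN; have := err N' w KN'.
set m := bmean h.+1 _; set m' := bmean h.+1 _.
have : `|m' - m| <= bmean h.+1 (fun a b => p a b w).
  rewrite /m /m' -bmeanB; apply: le_trans (ler_norm_bmean _ _) _.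
  apply: ler_bmean => a b _ _; rewrite /p; set z := (_, _).
  move: KN KN'; rewrite !geq_max => /andP[/and3P[_ a1 a2] a3] /andP[/and3P[_ b1 b2] b3].
  have := hQ1 N N' z; rewrite a1 a3 b1 b3 -/row_mean => /(_ isT isT) r1.
  have := hQ2 N N' z; rewrite a2 a3 b2 b3 -/col_mean => /(_ isT isT) r2.
  have -> : row_mean N z * col_mean N z - row_mean N' z * col_mean N' z =
    (row_mean N z - row_mean N' z) * col_mean N z +
    row_mean N' z * (col_mean N z - col_mean N' z) by ring.
  apply: le_trans (ler_normD _ _) _; apply: lerD; rewrite normrM.
    by rewrite -[leRHS]mulr1; apply: ler_pM; [| |exact: r1|exact: col_mean_le1].
  by rewrite -[leRHS]mul1r; apply: ler_pM; [| |exact: row_mean_le1|exact: r2].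
by rewrite !ler_norml => /andP[? ?] /andP[? ?] /andP[? ?]; lra.
Qed.

End Grid.

(* The duals of the cut norms of [g] at all scales have, along an ultrafilter,
   convergent correlation with [g]; near-minimal L2 norm in their convex hulls
   then yields one [h] whose averages oscillate little at every scale. *)
Lemma structured_approx g (e : R) : B g -> 0 < e -> exists h,
  [/\ B h, (forall w, `|h w| <= 1), osc_le B E e (avg h) &
      osc_le B E (2 * E (fun w => g w * h w) + e) (avg g)].
Proof.
move=> Bg e0.
have /choice[u /choice[v /choice[k ck]]] : forall n, exists u v k, cut_norm B S T g n u v k.
  by move=> n; exact: (exists_cut_norm mE pS pT n Bg).
have [U UU sU] := exists_ultra.
have e8 : 0 < e / 8 by lra.
have [K hK] := osc_cut_dual ck UU sU e8.
pose D n := cut_dual S' T' n (u n) (v n).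
have ED n : E (fun w => g w * D n w) = E (k n).
  exact: (E_cut_dual mE pS pT pS' pT' SK TK T'K comm Bg (ck n)).
have [C gC] := B_bnd mE Bg.
have EkC n : `|E (k n)| <= `|C|.
  rewrite -ED; apply: (E_norm_le mE).
    by apply: (B_mul mE) => //; exact: (B_cut_dual mE pS' pT' (ck n)).
  move=> w; rewrite normrM -[leRHS]mulr1; apply: ler_pM => //.
    exact: le_trans (gC w) (ler_norm _).
  exact: (cut_dual_le1 S' T' (ck n) w).
have /cvg_ex[L EkL] := ultra_cvg UU EkC.
have /cvgrPdist_le/(_ _ e8) nearL := EkL.
(* Every condition here passes to midpoints. Using the limit [L] instead of the varying [E (k n)]
   makes the correlation constraint the same at all scales. *)
pose Cs (s : nat) h := [/\ B h, (forall w, `|h w| <= 1),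
  `|E (fun w => g w * h w) - L| <= e / 8 &
  exists Q, [/\ B Q, E Q <= e / 8 & forall N N' w, (K <= N <= s)%N -> (K <= N' <= s)%N ->
    `|avg h N w - avg h N' w| <= Q w]].
have Cne s : exists2 h, Cs s h & E (fun w => h w ^+ 2) <= 1.
  have [n [/= QD LD]] := filter_ex (filterI (hK s) nearL).
  have BD := B_cut_dual mE pS' pT' (ck n).
  have D1 := cut_dual_le1 S' T' (ck n).
  exists (D n); last first.
    apply: (E_le_cst mE) => [|w]; first exact: (B_mul mE).
    exact/sqr_le1/D1.
  by split=> //; rewrite ED distrC.
have Cdec s s' h : (s <= s')%N -> Cs s' h -> Cs s h.
  move=> ss' [Bh h1 hL [Q [BQ EQ hQ]]]; split=> //; exists Q; split=> // N N' w.
  move=> /andP[a b] /andP[a' b'].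
  by apply: hQ; rewrite ?a ?a' (leq_trans _ ss').
have CB s h : Cs s h -> B h by case.
have mid (x y r : R) : `|x| <= r -> `|y| <= r -> `|2^-1 * (x + y)| <= r.
  by rewrite !ler_norml => /andP[? ?] /andP[? ?]; lra.
have Cmid s h h' : Cs s h -> Cs s h' -> Cs s (fun w => 2^-1 * (h w + h' w)).
  move=> [Bh h1 hL [Q [BQ EQ hQ]]] [Bh' h1' hL' [Q' [BQ' EQ' hQ']]].
  have Bhh := B_add mE Bh Bh'; have BQQ := B_add mE BQ BQ'.
  have Bgh := B_mul mE Bg Bh; have Bgh' := B_mul mE Bg Bh'.
  split; first exact: (B_scale mE).
  - by move=> w; exact: mid.
  - have -> : (fun w => g w * (2^-1 * (h w + h' w))) = (fun w => 2^-1 * (g w * h w + g w * h' w)).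
      by apply/funext => w; ring.
    rewrite (E_scale mE _ (B_add mE Bgh Bgh')) (E_add mE Bgh Bgh').
    by have := mid _ _ _ hL hL'; congr (`|_| <= _); field.
  exists (fun w => 2^-1 * (Q w + Q' w)); split; first exact: (B_scale mE).
    by rewrite (E_scale mE _ BQQ) (E_add mE BQ BQ'); lra.
  move=> N N' w KN KN'; rewrite !avg12Z !avg12D.
  have := hQ _ _ w KN KN'; have := hQ' _ _ w KN KN'.
  by rewrite !ler_norml => /andP[? ?] /andP[? ?]; lra.
have [dl dl0 maxdl] := maximal_small_sqr mE pS pT comm (ltr0Sn R 1) e8.
have [s [_ [h Ch nearh]]] := conv_cauchy mE Cne Cdec CB Cmid 0 dl0.
have [Bh h1 hL _] := Ch; exists h; split=> //.
- exists K => n; have [h' Ch' hh'] := nearh n.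
  have [Bh' h1' _ [Q [BQ EQ hQ]]] := Ch'.
  have hh2 w : `|h w - h' w| <= 2.
    by apply: le_trans (ler_normB _ _) _; have := h1 w; have := h1' w; lra.
  have [Q' [BQ' EQ' hQ']] := maxdl _ (B_sub mE Bh Bh') hh2 hh' n.
  have BQ2 := B_scale mE 2 BQ'.
  exists (fun w => Q w + 2 * Q' w); split; first exact: (B_add mE).
    by rewrite (E_add mE BQ BQ2) (E_scale mE _ BQ'); lra.
  move=> N N' w KN KN'; have := hQ _ _ w KN KN'.
  have Nn : (N <= n)%N by case/andP: KN.
  have Nn' : (N' <= n)%N by case/andP: KN'.
  have := le_trans (avg12_close S T f1_le1 f2_le1 h h' N w) (hQ' N w Nn).
  have := le_trans (avg12_close S T f1_le1 f2_le1 h h' N' w) (hQ' N' w Nn').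
  by rewrite !ler_norml => /andP[? ?] /andP[? ?] /andP[? ?]; lra.
- have [n LE] := filter_ex nearL.
  apply: osc_le_trans (osc_le_cut mE pS pT comm f1_le1 f2_le1 Bg (ck n) e8) _.
  by move: LE hL; rewrite !ler_norml => /andP[? ?] /andP[? ?]; lra.
Qed.

(** Adding a structured function to a candidate costs some oscillation, so the distance to [f] is
    minimized along a sequence of classes rather than in a single one. *)
Lemma osc_avg12 f (e : R) : B f -> 0 < e -> osc_le B E e (avg f).
Proof.
move=> Bf e0.
pose Cs (s : nat) h := B h /\ osc_le B E s.+1%:R^-1 (avg h).
pose q h := E (fun w => (f w - h w) ^+ 2).
have Bq h : B h -> B (fun w => (f w - h w) ^+ 2).
  by move=> Bh; apply: (B_mul mE); exact: (B_sub mE).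
have q0 s h : Cs s h -> 0 <= q h.
  by move=> [Bh _]; apply: (E_ge0 mE); [exact: Bq|move=> w; exact: sqr_ge0].
have osc0 r : 0 <= r -> osc_le B E r (avg (fun=> 0)).
  move=> r0; exists 0%N => n; exists (fun=> 0); split; first exact: (B_cst mE).
    by rewrite (E_cst mE).
  move=> N N' w _ _; have avg0 M : avg (fun=> 0) M w = 0.
    rewrite -[RHS](mul0r (avg (fun=> 0) M w)) -avg12Z.
    by apply: eq_bmean => i j _ _; rewrite mul0r.
  by rewrite !avg0 subrr normr0.
have Cne s : exists2 h, Cs s h & q h <= q (fun=> 0).
  by exists (fun=> 0) => //; split; [exact: (B_cst mE)|apply: osc0; rewrite invr_ge0].
have [r [r0 r1 re]] : exists r : R, [/\ 0 < r, r <= 1 & r <= e / 8].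
  exists (Num.min 1 (e / 8)); rewrite lt_min !ge_min !lexx orbT ltr01/=; split=> //.
  by lra.
have [s0 s00 smalls0] := div_small 1 r0.
have [s s0s near] := near_min Cne q0 s0 (exprn_gt0 2 r0).
have sinv0 : 0 < s.+1%:R^-1 :> R by rewrite invr_gt0.
have sr : s.+1%:R^-1 <= r by rewrite -div1r smalls0// leqW.
have hinv : (s.*2.+1).+1%:R^-1 = s.+1%:R^-1 / 2 :> R.
  by rewrite -doubleS -muln2 natrM invfM.
(* Scale [2 * s + 1] halves the oscillation allowed at scale [s], leaving the other half for the
   perturbation [r * h']. *)
have [|h [Bh osch] minh] := near s.*2.+1; first by rewrite -addnn; lia.
rewrite hinv in osch.
pose g w := f w - h w; have Bg : B g by exact: (B_sub mE).
have e3 : 0 < s.+1%:R^-1 / 2 :> R by exact: divr_gt0.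
have [h' [Bh' h1' osch' oscg]] := structured_approx Bg e3.
have Bgh := B_mul mE Bg Bh'.
(* Comparing [h] with [h + r * h'] gives [2 * r * E (g h') <= r ^ 2 + r ^ 2 * E (h' ^ 2)], hence the
   bound after division by [2 * r]. *)
have Ehr : E (fun w => g w * h' w) <= r.
  have Ck : Cs s (fun w => h w + r * h' w).
    split; first by apply: (B_add mE) => //; exact: (B_scale mE).
    have -> : avg (fun w => h w + r * h' w) = (fun N w => avg h N w + r * avg h' N w).
      by apply/funext => N; apply/funext => w; rewrite avg12D avg12Z.
    apply: osc_le_trans (osc_le_add mE osch (osc_le_scale mE r osch')) _.
    rewrite gtr0_norm//; have := ler_wpM2r (ltW sinv0) r1.
    by set x := s.+1%:R^-1; lra.
  have := minh _ Ck; rewrite /q.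
  have -> : (fun w => (f w - (h w + r * h' w)) ^+ 2) = (fun w => ((f w - h w) ^+ 2 -
     (2 * r) * (g w * h' w)) + r ^+ 2 * h' w ^+ 2).
    by apply/funext => w; rewrite /g; ring.
  have Bg2 := Bq h Bh; have Bh2 : B (fun w => h' w ^+ 2) by exact: (B_mul mE).
  rewrite (E_add mE (B_sub mE Bg2 (B_scale mE _ Bgh)) (B_scale mE _ Bh2)).
  rewrite (E_sub mE Bg2 (B_scale mE _ Bgh)) (E_scale mE _ Bgh) (E_scale mE _ Bh2).
  have : E (fun w => h' w ^+ 2) <= 1.
    by apply: (E_le_cst mE) => // w; exact/sqr_le1/h1'.
  by nra.
have -> : avg f = (fun N w => avg h N w + avg g N w).
  apply/funext => N; apply/funext => w; rewrite -avg12D.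
  by congr (avg _ N w); apply/funext => y; rewrite /g addrC subrK.
apply: osc_le_trans (osc_le_add mE osch oscg) _.
by move: sr; set x := s.+1%:R^-1; lra.
Qed.

End StructuredApproximation.

(** * The integral of a probability measure as a mean *)

Section ProbabilityMean.
Context {d : measure_display} {X : measurableType d} {R : realType}.
Variable mu : probability X R.
Implicit Types (f g : X -> R).

(** The bound holds everywhere, not almost everywhere, because means compare functions pointwise. *)
Definition bounded_measurable f := measurable_fun setT f /\ exists C : R, forall x, `|f x| <= C.

Local Notation B := bounded_measurable.

Definition expect f : R := Rintegral mu setT f.

Lemma bm_integrable f : B f -> mu.-integrable setT (EFin \o f).
Proof.
move=> [mf [C fC]]; apply: measurable_bounded_integrable => //.
  by apply: (le_lt_trans (probability_le1 mu measurableT)); exact: ltry.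
exists C; split; first exact: num_real.
by move=> M CM x _ /=; apply: le_trans (fC x) (ltW CM).
Qed.

Lemma bm_is_mean : is_mean B expect.
Proof.
split.
- by move=> c; split=> //; exists `|c|.
- move=> f g [mf [C fC]] [mg [D gD]]; split; first exact: measurable_funD.
  by exists (C + D) => z; apply: le_trans (ler_normD _ _) _; exact: lerD.
- move=> f g [mf [C fC]] [mg [D gD]]; split; first exact: measurable_funM.
  by exists (C * D) => z; rewrite normrM; exact: ler_pM.
- move=> f [mf _]; split; last first.
    by exists 1 => z; case: ltP => _; rewrite ?normr1 ?normr0.
  have := @measurable_fun_ifT _ _ _ _ (cst (1 : R)) (cst 0) (fun x => 0 < f x).
  rewrite (_ : (fun t => if _ then _ else _) = (fun x => (0 < f x)%R%:R)); last first.
    by apply/funext => x; case: ifP.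
  by apply=> //; exact: measurable_fun_ltr.
- by move=> f [_].
- move=> c; rewrite /expect Rintegral_cst// (_ : fine _ = 1) ?mulr1//.
  exact: (congr1 fine (probability_setT mu)).
- by move=> f g /bm_integrable mf /bm_integrable mg; exact: RintegralD.
- by move=> c f /bm_integrable mf; exact: RintegralZl.
- by move=> f g /bm_integrable mf /bm_integrable mg fg; exact: le_Rintegral.
Qed.

Definition measure_preserving (S : X -> X) := measurable_fun setT S /\
  forall A, measurable A -> mu (S @^-1` A) = mu A.

Lemma mp_preserves S : measure_preserving S -> preserves B expect S.
Proof.
move=> [mS Smu] f Bf; have [mf [C fC]] := Bf.
have BfS : B (fun x => f (S x)) by split; [exact: measurableT_comp|exists C].
split=> //; rewrite /expect /Rintegral; congr fine.
transitivity (\int[pushforward mu S]_x (f x)%:E)%E.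
  rewrite (integral_pushforward mS (f := EFin \o f))//.
  - exact/measurable_EFinP.
  - exact: bm_integrable BfS.
by apply: eq_measure_integral => A mA _; exact: Smu.
Qed.

Lemma mp_comp S T : measure_preserving S -> measure_preserving T ->
  measure_preserving (fun x => S (T x)).
Proof.
move=> [mS Smu] [mT Tmu]; split; first exact: measurableT_comp.
move=> A mA; rewrite -[RHS]Smu// -[RHS]Tmu//.
by rewrite -[X in measurable X]setTI; exact: mS.
Qed.

Lemma mp_iter S n : measure_preserving S -> measure_preserving (iter n S).
Proof.
move=> pS; elim: n => [|n IH]; first by split=> //; exact: measurable_id.
exact: (mp_comp pS IH).
Qed.

Lemma mp_inverse S S' : measure_preserving S -> measurable_fun setT S' ->
  cancel S S' -> measure_preserving S'.
Proof.
move=> [mS Smu] mS' SK; split=> // A mA.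
rewrite -[LHS]Smu; last by rewrite -[X in measurable X]setTI; exact: mS'.
by rewrite -comp_preimage; congr (mu _); apply/seteqP; split => x /=; rewrite SK.
Qed.

Lemma mp_ae S (P : X -> Prop) : measure_preserving S ->
  {ae mu, forall x, P x} -> {ae mu, forall x, P (S x)}.
Proof.
move=> [mS Smu] [N [mN N0 PN]]; exists (S @^-1` N); split.
- by rewrite -[X in measurable X]setTI; exact: mS.
- by rewrite Smu.
- by move=> x nP; apply: PN.
Qed.

(** * From oscillation bounds to almost everywhere convergence *)

Section Convergence.
Variable G : nat -> X -> R.
Hypothesis mG : forall N, measurable_fun setT (G N).

Let dev (e : R) N N' := [set x | e < `|G N x - G N' x|].

Let osc_set (e : R) K n := \bigcup_(N in [set N | (K <= N <= n)%N])
  \bigcup_(N' in [set N | (K <= N <= n)%N]) dev e N N'.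

Let measurable_dev e N N' : measurable (dev e N N').
Proof.
rewrite -[X in measurable X]setTI.
have : measurable_fun setT (fun x => e < `|G N x - G N' x|).
  apply: measurable_fun_ltr => //.
  by apply: measurableT_comp => //; exact: measurable_funB.
by move=> /(_ measurableT [set true]); exact.
Qed.

Let measurable_osc_set e K n : measurable (osc_set e K n).
Proof. by apply: bigcup_measurable => N _; apply: bigcup_measurable. Qed.

(** Markov's inequality: [Q] is at least [e] on [osc_set e K n]. *)
Let mu_osc_set (e r : R) K n Q : 0 < e -> B Q -> expect Q <= e * r ->
  (forall x, 0 <= Q x) ->
  (forall N N' x, (K <= N <= n)%N -> (K <= N' <= n)%N -> `|G N x - G N' x| <= Q x) ->
  (mu (osc_set e K n) <= r%:E)%E.
Proof.
move=> e0 BQ EQ Q0 hQ.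
have mI : B (\1_(osc_set e K n) : X -> R).
  split; first exact: measurable_indic.
  by exists 1 => x; rewrite indicE; case: (_ \in _); rewrite ?normr1 ?normr0.
have : expect (fun x => e * \1_(osc_set e K n) x) <= e * r.
  apply: le_trans EQ; apply: (E_le bm_is_mean) => //; first exact: (B_scale bm_is_mean).
  move=> x; rewrite indicE; case: (boolP (x \in osc_set e K n)) => /= [|_]; last by rewrite mulr0.
  rewrite inE => -[N KN [N' KN']] /= /ltW eG; rewrite mulr1.
  by apply: le_trans eG _; exact: hQ.
rewrite (E_scale bm_is_mean)// ler_pM2l// /expect /Rintegral integral_indic// setIT => le.
rewrite -[mu _]fineK ?lee_fin//.
exact: fin_num_measure.
Qed.

(** Countable additivity enters here: continuity from below turns bounds uniform in [n] into one for
    the union over [n]. Intersecting over [K] gives a null set for each threshold [1 / (m + 1)], and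
    outside their union the sequence is Cauchy. *)
Lemma osc_le_ae_cvg : (forall e, 0 < e -> osc_le B expect e G) ->
  {ae mu, forall x, cvgn (fun N => G N x)}.
Proof.
move=> hG.
have bad (m : nat) : mu.-negligible
    [set x | forall K, exists n, osc_set m.+1%:R^-1 K n x].
  pose e : R := m.+1%:R^-1; have e0 : 0 < e by rewrite invr_gt0.
  have small (r : R) : 0 < r -> exists K, (mu (\bigcup_n osc_set e K n) <= r%:E)%E.
    move=> r0; have [K hK] := hG _ (mulr_gt0 e0 r0); exists K.
    have mono n n' : (n <= n')%N -> osc_set e K n `<=` osc_set e K n'.
      move=> nn' x [N /andP[a b] [N' /andP[a' b'] D]].
      exists N; first by rewrite /= a (leq_trans b).
      by exists N' => //; rewrite /= a' (leq_trans b').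
    have cv := @nondecreasing_cvg_mu _ _ _ mu (osc_set e K) (measurable_osc_set e K)
      (bigcup_measurable (fun n _ => measurable_osc_set e K n)).
    have {}cv := cv (fun n n' nn' => introT (@subsetPset _ _ _) (mono n n' nn')).
    have <- := cvg_lim (@ereal_hausdorff R) cv.
    apply: lime_le; first by apply/cvg_ex; exists (mu (\bigcup_n osc_set e K n)).
    (* For [n >= K] the window contains [K], and comparing [G K] with itself gives [0 <= Q]. *)
    exists K => // n /= Kn; have [Q [BQ EQ hQ]] := hK n.
    apply: (mu_osc_set e0 BQ EQ) => // x.
    by apply: le_trans (hQ K K x _ _); rewrite // leqnn.
  have badE : [set x | forall K, exists n, osc_set e K n x] =
      \bigcap_K \bigcup_n osc_set e K n.
    apply/seteqP; split => x /= h K; first by move=> _; have [n ?] := h K; exists n.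
    by have [n _ ?] := h K I; exists n.
  have mbad : measurable [set x | forall K, exists n, osc_set e K n x].
    by rewrite badE; apply: bigcapT_measurable => K; apply: bigcup_measurable.
  apply/negligibleP => //.
  apply/eqP; rewrite eq_le measure_ge0 andbT; apply/lee_addgt0Pr => r r0.
  rewrite add0e; have [K hK] := small r r0; apply: le_trans hK.
  apply: le_measure; rewrite ?inE//; first exact: bigcup_measurable.
  by move=> x /(_ K)[n]; exists n.
apply: negligibleS (negligible_bigcup bad) => x /= ncv; apply: contrapT => nbad.
apply: ncv; apply/cauchy_cvgP/cauchy_exP => e e0.
have e20 : 0 < e / 2 by lra.
have [m _ smallm] := div_small 1 e20.
have /existsNP[L hL] : ~ forall K, exists n, osc_set m.+1%:R^-1 K n x.
  by move=> allK; apply: nbad; exists m.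
exists (G L x); exists L => // n /= Ln; rewrite /ball /=.
have [nG|Gn] := leP `|G L x - G n x| m.+1%:R^-1.
  apply: (le_lt_trans nG); rewrite -div1r.
  by apply: (le_lt_trans (smallm m.+1 (leqnSn m))); lra.
exfalso; apply: hL; exists n, L; first by rewrite /= leqnn.
by exists n => //; rewrite /= Ln leqnn.
Qed.

End Convergence.
End ProbabilityMean.

(** * Reduction from essentially bounded to bounded functions *)

Section Bilinear.
Context {d : measure_display} {X : measurableType d} {R : realType}.
Variable mu : probability X R.

Lemma avg2E (S T : X -> X) (f1 f2 f3 : X -> R) N x :
  avg2 S T f1 f2 f3 N x = avg12 S T f1 f2 f3 N x.
Proof.
rewrite /avg2 /avg12 /bmean; under [in RHS]eq_cmean do rewrite /cmean.
by rewrite cmeanZl /cmean mulrA -invfM expr2.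
Qed.

Lemma inv_mpt_mp S : inv_mpt mu S -> exists S',
  [/\ cancel S S', cancel S' S, measure_preserving mu S & measure_preserving mu S'].
Proof.
move=> [mS [[S' [SK [S'K mS']]] Smu]]; have pS : measure_preserving mu S by split.
by exists S'; split=> //; exact: mp_inverse pS mS' SK.
Qed.

(** Large values are replaced by [0], which leaves [f] unchanged wherever [|f| <= M]. *)
Definition clip (M : R) (f : X -> R) x : R := if `|f x| <= M then f x else 0.

Lemma clip_le M f x : 0 <= M -> `|clip M f x| <= M.
Proof. by move=> M0; rewrite /clip; case: ifP => //; rewrite normr0. Qed.

Lemma measurable_clip M f : measurable_fun setT f -> measurable_fun setT (clip M f).
Proof.
move=> mf; apply: measurable_fun_ifT => //; apply: measurable_fun_ler => //.
exact: measurableT_comp.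
Qed.

Lemma measurable_avg12 S T (f1 f2 f3 : X -> R) N :
  measurable_fun setT S -> measurable_fun setT T ->
  measurable_fun setT f1 -> measurable_fun setT f2 -> measurable_fun setT f3 ->
  measurable_fun setT (avg12 S T f1 f2 f3 N).
Proof.
move=> mS mT m1 m2 m3.
have mi (Q : X -> X) n : measurable_fun setT Q -> measurable_fun setT (iter n Q).
  move=> mQ; elim: n => [|n IH]; first exact: measurable_id.
  exact: (measurableT_comp mQ IH).
have mc n (F : nat -> X -> R) : (forall i, measurable_fun setT (F i)) ->
    measurable_fun setT (fun x => cmean n (F^~ x)).
  by move=> mF; apply: measurable_funM => //; apply: measurable_sum => i.
apply: (mc N (fun i x => cmean N (fun j => f1 (iter i S x) * f2 (iter j T x) *
  f3 (iter i S (iter j T x))))) => i.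
apply: (mc N (fun j x => f1 (iter i S x) * f2 (iter j T x) *
  f3 (iter i S (iter j T x)))) => j.
apply: measurable_funM; first by apply: measurable_funM; apply: measurableT_comp => //; exact: mi.
by apply: (measurableT_comp m3); apply: (measurableT_comp (mi _ i mS)); exact: mi.
Qed.

End Bilinear.

Theorem theorem1p1 (d : measure_display) (X : measurableType d) (R : realType)
  (mu : probability X R) (S T : X -> X) :
  standard_borel X R ->
  inv_mpt mu S -> inv_mpt mu T ->
  (forall x, S (T x) = T (S x)) ->
  ergodic2 mu S T ->
  forall f1 f2 f3 : X -> R,
    Linfty mu f1 -> Linfty mu f2 -> Linfty mu f3 ->
    {ae mu, forall x, cvgn (fun N => avg2 S T f1 f2 f3 N x)}.
Proof.
move=> _ iS iT comm _ f1 f2 f3 [m1 [M1 b1]] [m2 [M2 b2]] [m3 [M3 b3]].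
have [S' [SK S'K pS pS']] := inv_mpt_mp iS; have [T' [TK T'K pT pT']] := inv_mpt_mp iT.
pose M := 1 + `|M1| + `|M2| + `|M3|.
have M0 : 0 < M by rewrite /M -!addrA ltr_pwDl// !addr_ge0.
(* [c1] and [c2] are scaled to be at most [1] in absolute value, as [osc_avg12] asks; for [c3] any
   bound will do. *)
pose c1 x := M^-1 * clip M f1 x; pose c2 x := M^-1 * clip M f2 x; pose c3 := clip M f3.
have mc (f : X -> R) : measurable_fun setT f ->
    measurable_fun setT (fun x => M^-1 * clip M f x).
  by move=> mf; apply: measurable_funM => //; exact: measurable_clip.
have c1_le1 (f : X -> R) x : `|M^-1 * clip M f x| <= 1.
  rewrite normrM normfV (gtr0_norm M0) mulrC ler_pdivrMr// mul1r.
  by apply: clip_le; exact: ltW.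
have Bc (f : X -> R) : measurable_fun setT f -> bounded_measurable (fun x => M^-1 * clip M f x).
  by move=> mf; split; [exact: mc|exists 1; exact: c1_le1].
have B3 : bounded_measurable c3.
  by split; [exact: measurable_clip|exists M => x; apply: clip_le; exact: ltW].
have cvc : {ae mu, forall x, cvgn (fun N => avg12 S T c1 c2 c3 N x)}.
  apply: osc_le_ae_cvg => [N|e e0].
    by apply: measurable_avg12; [exact: pS.1|exact: pT.1|exact: mc|exact: mc|exact: B3.1].
  exact: (osc_avg12 (bm_is_mean mu) (mp_preserves pS) (mp_preserves pT)
    (mp_preserves pS') (mp_preserves pT') SK S'K TK T'K comm (Bc _ m1) (Bc _ m2)
    (c1_le1 f1) (c1_le1 f2) B3 e0).
(* Almost every point has its whole orbit in the set where clipping changes nothing: a countable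
   intersection of preimages under measure preserving maps. *)
have good (f : X -> R) Mf : `|Mf| <= M -> {ae mu, forall x, `|f x| <= Mf} ->
    {ae mu, forall x, forall i j, clip M f (iter i S (iter j T x)) = f (iter i S (iter j T x))}.
  move=> MfM bf; apply: ae_foralln => i; apply: ae_foralln => j.
  apply: (mp_ae (P := fun x => clip M f x = f x) (mp_comp (mp_iter i pS) (mp_iter j pT))).
  apply: filterS bf => x fx; rewrite /clip (le_trans fx)//.
  exact: le_trans (ler_norm _) MfM.
have g1 : `|M1| <= M by rewrite /M; have := normr_ge0 M2; have := normr_ge0 M3; lra.
have g2 : `|M2| <= M by rewrite /M; have := normr_ge0 M1; have := normr_ge0 M3; lra.
have g3 : `|M3| <= M by rewrite /M; have := normr_ge0 M1; have := normr_ge0 M2; lra.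
have {}g1 := good _ _ g1 b1; have {}g2 := good _ _ g2 b2; have {}g3 := good _ _ g3 b3.
apply: filterS (filterI cvc (filterI g1 (filterI g2 g3))) => x [cv [h1 [h2 h3]]].
(* The factor [M ^+ 2] undoes the scaling of [c1] and [c2]. *)
have -> : (fun N => avg2 S T f1 f2 f3 N x) = (fun N => M ^+ 2 * avg12 S T c1 c2 c3 N x).
  apply/funext => N; rewrite avg2E -bmeanZl; apply: eq_bmean => i j _ _.
  rewrite /c1 /c2 /c3 (h1 i 0%N) (h2 0%N j) h3; field.
  by rewrite gt_eqF.
by apply: is_cvgM => //; exact: is_cvg_cst.
Qed.
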